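(* Let $\phi_1:(0,\infty)\to(0,\infty)$ be a function satisfying: (i) $\phi_1(u_1)$ is non-decreasing and $\lim_{u_1\to\infty}\phi_1(u_1)=\alpha_{1E}:=\dfrac{1}{m_1E(\tau^{-1})}$; (ii) for all $u_1>0$, $$\phi_1(u_1)\ge \frac{1}{m_1+m_2}\;\frac{\displaystyle\int_0^{u_1}t^{\frac{m_2}{2}-1}(1+t)^{-\frac{m_1+m_2}{2}}\,dt}{E[\tau^{-1}]\displaystyle\int_0^{u_1}t^{\frac{m_2}{2}-1}(1+t)^{-\left(\frac{m_1+m_2}{2}+1\right)}\,dt}.$$ Then, with $Z_1=S_2/S_1$, the estimator $\delta_{\phi_1}=\phi_1(Z_1)S_1$ of $\sigma_1^2$ dominates the estimator $\delta_{01}^E=\alpha_{1E}S_1$ with respect to the entropy loss $L_2$.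
   Context: Model: $p,q,m_1,m_2$ are positive integers; $\tau$ is a positive random variable (mixing variable) with known distribution $\Pi$ on $(0,\infty)$, and $E(\tau^{-1})$ denotes the (finite) expectation of $\tau^{-1}$. Conditionally on $\tau$, the variables $\boldsymbol X_1,S_1,\boldsymbol X_2,S_2$ are independent with $\boldsymbol X_1\sim N_p(\boldsymbol\theta_1,\frac{\sigma_1^2}{\tau}I)$, $S_1\sim\frac{\sigma_1^2}{\tau}\chi^2_{m_1}$, $\boldsymbol X_2\sim N_q(\boldsymbol\theta_2,\frac{\sigma_2^2}{\tau}I)$, $S_2\sim\frac{\sigma_2^2}{\tau}\chi^2_{m_2}$ (the same $\tau$ for all four). The unknown parameters are $\boldsymbol\theta_1\in\mathbb R^p$, $\boldsymbol\theta_2\in\mathbb R^q$, $\sigma_1,\sigma_2>0$ with the order restriction $\sigma_1\le\sigma_2$. The entropy loss for estimating $\sigma^2$ by $\delta$ is $L_2(\delta,\sigma^2)=\delta/\sigma^2-\ln(\delta/\sigma^2)-1$; the risk of an estimator $\delta$ of $\sigma_1^2$ is $R(\delta)=E[L_2(\delta,\sigma_1^2)]$, a function of the parameters. $\delta_{01}^E$ is the best affine equivariant estimator (BAEE) of $\sigma_1^2$ under $L_2$. An estimator $\delta'$ dominates $\delta$ if $R(\delta')\le R(\delta)$ for all parameter values satisfying the order restriction, with strict inequality for at least one.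
   Formalization: The risk inequality is proved in general; strict inequality for some parameter is claimed only when φ₁ is not identically α₁E and the estimator α₁E·S₁ has finite risk, since otherwise the two estimators coincide or both have infinite risk everywhere. *)

(* Defs.v *)
From HB Require Import structures.
From mathcomp Require Import all_boot all_order all_algebra.
From mathcomp Require Import all_classical all_reals all_analysis.

Set Implicit Arguments.
Unset Strict Implicit.
Unset Printing Implicit Defensive.

Import Order.TTheory GRing.Theory Num.Theory.
Import numFieldNormedType.Exports.

Local Open Scope classical_set_scope.
Local Open Scope ring_scope.

Definition Gamma (R : realType) (a : R) : R :=
  \int[@lebesgue_measure R]_(t in `]0, +oo[) (t `^ (a - 1) * expR (- t)).

Definition chi2_pdf (R : realType) (m : nat) (x : R) : R :=
  if 0 < x then
    x `^ (m%:R / 2 - 1) * expR (- x / 2) / (2 `^ (m%:R / 2) * Gamma (m%:R / 2))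
  else 0.

Definition chi2_prob (R : realType) (m : nat) (A : set R) : \bar R :=
  (\int[@lebesgue_measure R]_(x in A) (chi2_pdf m x)%:E)%E.

(* The law c chi^2_m. *)
Definition scaled_chi2_prob (R : realType) (c : R) (m : nat) (A : set R) :
    \bar R :=
  chi2_prob m [set x | A (c * x)].

(* The law N_n(theta, v I) evaluated on the box B_1 x ... x B_n: the coordinates
   are independent N(theta_i, v). The second argument of [normal_prob] is a
   standard deviation. *)
Definition mvnormal_box (R : realType) (n : nat) (theta : n.-tuple R) (v : R)
    (B : 'I_n -> set R) : \bar R :=
  (\prod_(i < n) normal_prob (tnth theta i) (Num.sqrt v) (B i))%E.

Record params (R : realType) (p q : nat) := Params {
  theta1 : p.-tuple R;
  theta2 : q.-tuple R;
  sigma1 : R;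
  sigma2 : R }.

Definition order_restricted (R : realType) (p q : nat) (th : params R p q) :
    Prop :=
  [/\ 0 < sigma1 th, 0 < sigma2 th & sigma1 th <= sigma2 th].

(* Joint law of (tau, X1, S1, X2, S2): tau has law Pi and, conditionally on
   tau = t, the variables X1, S1, X2, S2 are independent with laws
   N_p(theta1, sigma1^2/t I), (sigma1^2/t) chi^2_m1, N_q(theta2, sigma2^2/t I)
   and (sigma2^2/t) chi^2_m2. The law is given on the measurable boxes, which
   generate the product sigma-algebra and are stable by intersection. *)
Definition mixture_model (R : realType) (d : measure_display)
    (T : measurableType d) (p q m1 m2 : nat) (Pi : probability R R)
    (tau : {mfun T >-> R}) (X1 : {mfun T >-> p.-tuple R})
    (S1 : {mfun T >-> R}) (X2 : {mfun T >-> q.-tuple R})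
    (S2 : {mfun T >-> R}) (th : params R p q) (P : probability T R) : Prop :=
  forall (A : set R) (B1 : 'I_p -> set R) (C1 : set R)
         (B2 : 'I_q -> set R) (C2 : set R),
    measurable A -> (forall i, measurable (B1 i)) -> measurable C1 ->
    (forall j, measurable (B2 j)) -> measurable C2 ->
    P [set w | [/\ A (tau w), (forall i, B1 i (tnth (X1 w) i)), C1 (S1 w),
                   (forall j, B2 j (tnth (X2 w) j)) & C2 (S2 w)]] =
    (\int[Pi]_(t in A `&` `]0%R, +oo[)
       (mvnormal_box (theta1 th) (sigma1 th ^+ 2 / t) B1 *
        scaled_chi2_prob (sigma1 th ^+ 2 / t) m1 C1 *
        mvnormal_box (theta2 th) (sigma2 th ^+ 2 / t) B2 *
        scaled_chi2_prob (sigma2 th ^+ 2 / t) m2 C2))%E.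

(* E(tau^-1), for tau of law Pi on (0, +oo). *)
Definition mean_inv (R : realType) (Pi : probability R R) : R :=
  \int[Pi]_(t in `]0, +oo[) t^-1.

Definition entropy_loss (R : realType) (delta s2 : R) : R :=
  delta / s2 - ln (delta / s2) - 1.

(* Risk for estimating sigma1^2; it is +oo when the loss is not integrable. *)
Definition risk (R : realType) (d : measure_display) (T : measurableType d)
    (p q : nat) (P : params R p q -> probability T R) (delta : T -> R)
    (th : params R p q) : \bar R :=
  'E_(P th)[(fun w => entropy_loss (delta w) (sigma1 th ^+ 2))].

Definition no_worse (R : realType) (d : measure_display) (T : measurableType d)
    (p q : nat) (P : params R p q -> probability T R) (delta' delta : T -> R) :
    Prop :=
  forall th, order_restricted th -> (risk P delta' th <= risk P delta th)%E.

Definition dominates (R : realType) (d : measure_display)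
    (T : measurableType d) (p q : nat) (P : params R p q -> probability T R)
    (delta' delta : T -> R) : Prop :=
  no_worse P delta' delta /\
  exists2 th, order_restricted th & (risk P delta' th < risk P delta th)%E.

Definition alpha1E (R : realType) (m1 : nat) (Pi : probability R R) : R :=
  1 / (m1%:R * mean_inv Pi).

(* Best among the affine equivariant estimators c S1 under the entropy loss:
   c = 1 / E(S1 / sigma1^2). *)
Definition baee1 (R : realType) (T : Type) (m1 : nat) (Pi : probability R R)
    (S1 : T -> R) : T -> R :=
  fun w => alpha1E m1 Pi * S1 w.

(* phi is a function on (0, +oo); it is extended by 0 outside, which only
   matters on the null event where S1 or S2 is not positive. *)
Definition delta_phi (R : realType) (T : Type) (phi : R -> R)
    (S1 S2 : T -> R) : T -> R :=
  fun w => let Z1 := S2 w / S1 w in (if 0 < Z1 then phi Z1 else 0) * S1 w.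

Definition lower_bound (R : realType) (m1 m2 : nat) (Pi : probability R R)
    (u : R) : R :=
  1 / (m1 + m2)%:R *
  ((\int[@lebesgue_measure R]_(t in `]0, u[)
      (t `^ (m2%:R / 2 - 1) * (1 + t) `^ (- ((m1 + m2)%:R / 2)))) /
   (mean_inv Pi *
    \int[@lebesgue_measure R]_(t in `]0, u[)
      (t `^ (m2%:R / 2 - 1) * (1 + t) `^ (- ((m1 + m2)%:R / 2 + 1))))).

(* Main.v *)
(** Write V = S1/s1 with s1 = sigma1^2, Z = S2/S1, alpha = alpha1E and
M = m1 + m2. Almost surely
  L(phi(Z) S1) + (alpha - phi(Z)) V = L(alpha S1) + (ln alpha - ln phi(Z)),
so it suffices to compare the expectations of the two nonnegative correction
terms. Both are integrals over the levels 0 < c < alpha (layer cake), with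
slices V 1{phi(Z) < c} and 1{phi(Z) < c}/c, and it is enough to show
P(phi(Z) < c) <= c E[V; phi(Z) < c] for each c. The change of variables from
two independent chi-squares to their ratio w gives both sides as integrals, up
to a common constant, of w^(m2/2-1) (1+w)^(-M/2) and of
c M E(1/tau) w^(m2/2-1) (1+w)^(-M/2-1) over {w : phi(k w) < c}, where
k = (sigma2/sigma1)^2 >= 1. By monotonicity of phi this set is an initial
interval on which phi(w) <= phi(k w) < c, and (ii) is exactly the required
inequality at its endpoint; it is strict when k > 1. *)

Require Import Defs.
From HB Require Import structures.
From mathcomp Require Import all_boot all_order all_algebra.
From mathcomp Require Import all_classical all_reals all_analysis.
From mathcomp Require Import measurable_realfun ring lra.

Import Order.TTheory GRing.Theory Num.Theory.
Import numFieldNormedType.Exports.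

Local Open Scope classical_set_scope.
Local Open Scope ring_scope.

Set Implicit Arguments.
Unset Strict Implicit.
Unset Printing Implicit Defensive.

(** Working level by level replaces differentiation of [phi], which is only known to be monotone and
    may jump. The risks themselves may be infinite: a finite [E(1/tau)] does not control the upper
    tail of [ln tau], which enters the loss through [- ln V]. The loss identity is therefore kept as
    an equality of sums of nonnegative terms, and only the expectation of [(alpha - phi(Z)) V],
    which is finite, is ever cancelled. Strict inequality is obtained when the risk of [alpha S1] is
    finite. Given [tau], the ratio [Z] has a law free of [tau]; the mixing variable thus acts only
    through [E(1/tau)], multiplying the moment that contains [V]. The factor [M] beside it is
    [2 (M/2)], from the functional equation of Gamma at [M/2]. Positivity and finiteness of the
    Gamma and beta constants are read off from the total mass 1 of [P]. *)

(** * Measures given by a density *)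

Section density.
Local Open Scope ereal_scope.
Context {d : measure_display} {T : measurableType d} {R : realType}.
Variables (m : {measure set T -> \bar R}) (f : {mfun T >-> R}).
Hypothesis f0 : forall x, (0 <= f x)%R.

(* The phantom proof argument makes [density] a measure by inference. *)
Definition density (_ : forall x, (0 <= f x)%R) (A : set T) : \bar R :=
  \int[m]_(x in A) (f x)%:E.

Let mdensity := density f0.

Let density_set0 : mdensity set0 = 0.
Proof. by rewrite /mdensity /density integral_set0. Qed.

Let density_ge0 A : 0 <= mdensity A.
Proof. by apply: integral_ge0 => x _; rewrite lee_fin. Qed.

Let density_sigma_additive : semi_sigma_additive mdensity.
Proof.
move=> A mA tA mUA; rewrite /mdensity /density ge0_integral_bigcup//=.
- by apply: is_cvg_ereal_nneg_natsum_cond => n _ _; exact: density_ge0.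
- exact/measurable_EFinP/measurable_funTS.
- by move=> x _; rewrite lee_fin.
Qed.

HB.instance Definition _ := isMeasure.Build _ _ _ (density f0)
  density_set0 density_ge0 density_sigma_additive.

Import HBNNSimple.

Let integral_density_nnsfun (h : {nnsfun T >-> R}) :
  \int[density f0]_x (h x)%:E = \int[m]_x ((h x)%:E * (f x)%:E).
Proof.
under [LHS]eq_integral do rewrite fimfunE -fsumEFin//.
rewrite [LHS]ge0_integral_fsum//; last 2 first.
  - by move=> r; exact/measurable_EFinP/measurableT_comp.
  - by move=> n x _; rewrite EFinM nnfun_muleindic_ge0.
under [RHS]eq_integral.
  move=> x xD; rewrite fimfunE -fsumEFin// ge0_mule_fsuml; last first.
    by move=> r; rewrite EFinM nnfun_muleindic_ge0.
  over.
rewrite [RHS]ge0_integral_fsum//; last 2 first.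
  - move=> r; apply: emeasurable_funM.
      by apply/measurable_EFinP; exact/measurableT_comp.
    exact/measurable_EFinP.
  - move=> n x _; rewrite mule_ge0 ?lee_fin//.
    by rewrite -lee_fin EFinM nnfun_muleindic_ge0.
apply: eq_fsbigr => r; rewrite inE => -[x _ <-].
under [RHS]eq_integral do rewrite EFinM -muleA.
have hx0 : (0 <= h x)%R by [].
rewrite [RHS]ge0_integralZl//; last 2 first.
  - by apply: emeasurable_funM; exact/measurable_EFinP.
  - by move=> y _; rewrite mule_ge0 ?lee_fin.
under [LHS]eq_integral do rewrite EFinM.
rewrite [LHS]ge0_integralZl//; last first.
  by apply/measurable_EFinP.
rewrite integral_indic//= setIT /density; congr (_ * _).
rewrite integral_mkcond; apply: eq_integral => y _.
by rewrite patchE indicE; case: ifP => _; rewrite ?mul1e ?mul0e.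
Qed.

Lemma ge0_integral_density (g : T -> \bar R) :
  measurable_fun setT g -> (forall x, 0 <= g x) ->
  \int[density f0]_x g x = \int[m]_x (g x * (f x)%:E).
Proof.
move=> mg g0; pose g_ := nnsfun_approx measurableT mg.
transitivity (limn (fun n => \int[density f0]_x (g_ n x)%:E)).
  rewrite -monotone_convergence//=.
  - apply: eq_integral => x _; apply/esym/cvg_lim => //=.
    exact: cvg_nnsfun_approx.
  - by move=> n; exact/measurable_EFinP.
  - by move=> n x _; rewrite lee_fin.
  - by move=> x _ a b ab; rewrite lee_fin//; exact/lefP/nd_nnsfun_approx.
under eq_fun do rewrite integral_density_nnsfun.
rewrite -monotone_convergence//=.
- apply: eq_integral => x _; apply/cvg_lim => //=.
  apply: cvgeZr => //; exact: cvg_nnsfun_approx.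
- by move=> n; apply: emeasurable_funM; exact/measurable_EFinP.
- by move=> n x _; rewrite mule_ge0 ?lee_fin.
- move=> x _ a b ab; rewrite lee_wpmul2r ?lee_fin//.
  exact/lefP/nd_nnsfun_approx.
Qed.

End density.

(* The measure structure of [pushforward] takes the measurability proof as an
   argument that inference cannot find, hence the explicit instance. *)
Definition image_measure (d d' : measure_display) (T : measurableType d)
    (T' : measurableType d') (R : realFieldType) (m : {measure set T -> \bar R})
    (f : T -> T') (mf : measurable_fun setT f) : {measure set T' -> \bar R} :=
  measure_function_pushforward__canonical__measure_function_Measure m mf.
Arguments image_measure {d d' T T' R} m [f] mf.

(** * Scaling of Lebesgue measure; gamma and power integrals *)

Section real_integrals.
Context {R : realType}.
Local Notation mu := (@lebesgue_measure R).

Lemma measurable_invr : measurable_fun [set: R] (fun x : R => x^-1).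
Proof.
(* The identity also holds at 0, where both sides are 0 by the convention [0^-1 = 0]; this reduces
   the claim to the measurability of [powR]. *)
have -> : (fun x : R => x^-1) = (fun x => x * (`|x| `^ (- 2%:R))).
  apply/funext => x; rewrite powRN powR_mulrn// real_normK ?num_real//.
  have [->|x0] := eqVneq x 0; first by rewrite invr0 mul0r.
  by rewrite expr2 invfM mulrA divff// mul1r.
apply: measurable_funM => //.
apply: (measurableT_comp (@measurable_powR R _)).
exact: normr_measurable.
Qed.

(** The right-hand side is a measure in [A] that gives half-open intervals their length, and this
    characterises Lebesgue measure. *)
Lemma lebesgue_measure_scale (s : R) : 0 < s -> forall A, measurable A ->
  mu A = (s%:E * mu [set x | A (s * x)%R])%E.
Proof.
move=> s0 A mA.
have ms : @measurable_fun _ _ (measurableTypeR R) (measurableTypeR R) setT ( *%R s) by exact: measurable_funM.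
pose nu : {measure set (measurableTypeR R) -> \bar R} :=
  mscale (NngNum (ltW s0)) (image_measure mu ms).
suff -> : mu A = nu A by [].
apply: lebesgue_measure_unique => // _ [[a b]] _ <-.
rewrite /nu /= /mscale/= /image_measure/= /pushforward.
have -> : ( *%R s) @^-1` `]a, b] = `]s^-1 * a, s^-1 * b]%classic.
  apply/seteqP; split => x /=; rewrite !in_itv/=.
    by rewrite ltr_pdivrMl// ler_pdivlMl.
  by rewrite ltr_pdivrMl// ler_pdivlMl.
rewrite [LHS]lebesgue_measure_itv/= [in RHS]lebesgue_measure_itv/= !lte_fin.
rewrite ltr_pM2l ?invr_gt0//; case: ifP => _; last by rewrite mule0.
by rewrite -!EFinB -EFinM -mulrBr mulrA divff ?gt_eqF// mul1r.
Qed.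

Lemma ge0_integral_scale (s : R) (f : R -> \bar R) : 0 < s ->
  measurable_fun [set: R] f -> (forall x, 0 <= f x)%E ->
  (\int[mu]_x f x = s%:E * \int[mu]_x f (s * x)%R)%E.
Proof.
move=> s0 mf f0.
have ms : @measurable_fun _ _ (measurableTypeR R) (measurableTypeR R) setT ( *%R s) by exact: measurable_funM.
pose nu : {measure set (measurableTypeR R) -> \bar R} :=
  mscale (NngNum (ltW s0)) (image_measure mu ms).
transitivity (\int[nu]_x f x)%E.
  by apply: eq_measure_integral => A mA _; exact: lebesgue_measure_scale.
rewrite /nu ge0_integral_mscale//; congr (_ * _)%E.
by rewrite ge0_integral_pushforward.
Qed.

(** The rate [s] is a parameter because it becomes [1 + w] when a chi-square variable is integrated
    out at fixed ratio [w], and the Tonelli variable [t] in the gamma recurrence. *)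
Definition gamma_kernel (b s x : R) : R :=
  if 0 < x then x `^ b * expR (- (s * x) / 2) else 0.

Lemma gamma_kernel_ge0 b s x : 0 <= gamma_kernel b s x.
Proof.
by rewrite /gamma_kernel; case: ifP => // _; rewrite mulr_ge0 ?powR_ge0 ?expR_ge0.
Qed.

Lemma measurable_gamma_kernel2 b :
  measurable_fun [set: R * R] (fun z => gamma_kernel b z.1 z.2).
Proof.
apply: measurable_fun_ifT => //.
  exact: measurable_fun_ltr.
apply: measurable_funM.
  exact: (measurableT_comp (@measurable_powR R _)).
apply: (@measurableT_comp _ _ _ _ _ _ (@expR R)) => //.
apply: measurable_funM => //.
by apply: measurableT_comp => //; apply: measurable_funM.
Qed.

Lemma measurable_gamma_kernel b s : measurable_fun [set: R] (gamma_kernel b s).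
Proof.
exact: (@measurableT_comp _ _ _ _ _ _
  (fun z : R * R => gamma_kernel b z.1 z.2) _ (pair s)
  (measurable_gamma_kernel2 b)).
Qed.

(** For [b > -1] this is [2^(b+1) Gamma(b+1)], kept in the extended reals so that Tonelli applies
    before finiteness is known. *)
Definition gamma_mass (b : R) : \bar R := (\int[mu]_x (gamma_kernel b 1 x)%:E)%E.

Lemma gamma_mass_ge0 b : (0 <= gamma_mass b)%E.
Proof. by apply: integral_ge0 => x _; rewrite lee_fin gamma_kernel_ge0. Qed.

Lemma integral_gamma_kernel b s : 0 < s ->
  (\int[mu]_x (gamma_kernel b s x)%:E = (s `^ (- (b + 1)))%:E * gamma_mass b)%E.
Proof.
move=> s0; rewrite /gamma_mass [in RHS](ge0_integral_scale s0); last 2 first.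
- by apply/measurable_EFinP; exact: measurable_gamma_kernel.
- by move=> x; rewrite lee_fin gamma_kernel_ge0.
have E x : (gamma_kernel b 1 (s * x))%:E = ((s `^ b)%:E * (gamma_kernel b s x)%:E)%E.
  rewrite /gamma_kernel pmulr_rgt0//; case: ifPn => x0; last by rewrite mule0.
  by rewrite powRM ?(ltW s0) ?(ltW x0)// mul1r -EFinM mulrA.
under [in RHS]eq_integral do rewrite E.
rewrite ge0_integralZl//; last 3 first.
- by apply/measurable_EFinP; exact: measurable_gamma_kernel.
- by move=> x _; rewrite lee_fin gamma_kernel_ge0.
- by rewrite lee_fin powR_ge0.
rewrite !muleA -!EFinM.
suff -> : s `^ (- (b + 1)) * s * s `^ b = 1 by rewrite mul1e.
rewrite -{2}(powRr1 (ltW s0)) -!powRD ?(gt_eqF s0) ?implybT//.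
by rewrite (_ : - (b + 1) + 1 + b = 0) ?powRr0//; ring.
Qed.

Lemma integral_powR_tail (b : R) : 0 < b ->
  (\int[mu]_(x in `[1%R, +oo[) (x `^ (- (b + 1)))%:E = (b^-1)%:E)%E.
Proof.
move=> b0.
pose F (x : R) := (- b)^-1 * x `^ (- b).
have dF (x : R) : 0 < x -> is_derive x 1 F (x `^ (- (b + 1))).
  move=> x0; have dp := is_derive1_powR (- b) x0.
  have := is_deriveZ (- b)^-1 dp.
  by rewrite /GRing.scale/= mulrA mulVf ?oppr_eq0 ?gt_eqF// mul1r opprD.
rewrite (@ge0_continuous_FTC2y _ _ F _ 0)//.
- by rewrite /F powR1 mulr1 sub0e -EFinN invrN opprK.
- by move=> x _; exact: powR_ge0.
- apply: derivable_within_continuous => x; rewrite in_itv/= andbT => x1.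
  by apply: derivable_powR; rewrite in_itv/= andbT (lt_le_trans _ x1).
- rewrite -(mulr0 ((- b)^-1)); apply: cvgMr => //.
  apply/cvgrPdist_le => e e0; near=> x.
  have x0 : 0 < x by near: x; exact: nbhs_pinfty_gt.
  rewrite sub0r normrN ger0_norm ?powR_ge0//.
  (* The threshold is the solution of [x^(-b) = e]. *)
  have ex : e `^ (- b^-1) <= x by near: x; exact: nbhs_pinfty_ge.
  rewrite powRN -[leRHS]invrK lef_pV2 ?posrE ?powR_gt0 ?invr_gt0//.
  rewrite (_ : e^-1 = (e `^ (- b^-1)) `^ b).
    by apply: ge0_ler_powR => //; rewrite ?nnegrE ?powR_ge0// ltW.
  by rewrite -powRrM mulNr mulVf ?gt_eqF// powRN powRr1// ltW.
- move=> x x1; have x0 : 0 < x by apply: lt_trans x1.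
  exact: (@ex_derive _ _ _ _ _ _ _ (dF x x0)).
- apply: cvg_at_right_filter.
  have /derivable1_diffP/differentiable_continuous := @ex_derive _ _ _ _ _ _ _ (dF 1 ltr01).
  exact.
- move=> x; rewrite in_itv/= andbT => x1; have x0 : 0 < x by apply: lt_trans x1.
  by rewrite derive1E; exact: (@derive_val _ _ _ _ _ _ _ (dF x x0)).
Unshelve. all: end_near. Qed.

End real_integrals.

(** * The functional equation of Gamma *)

Section gamma_recurrence.
Context {R : realType}.
Local Notation mu := (@lebesgue_measure R).

Lemma integral_expR_tail (c : R) : 0 < c ->
  (\int[mu]_(t in `[1%R, +oo[) (c * expR (- (t * c)))%:E = (expR (- c))%:E)%E.
Proof.
move=> c0.
pose F (t : R) := - expR (- (t * c)).
have dF (t : R) : is_derive t 1 F (c * expR (- (t * c))).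
  have dc : is_derive t 1 (fun t : R => - (t * c)) (- c).
    apply: is_deriveN; rewrite (_ : (fun t : R => t * c) = c *: (@id R)); last first.
      by apply/funext => y; rewrite /GRing.scale/= mulrC.
    by have := is_deriveZ c (is_derive_id t 1); rewrite /GRing.scale/= mulr1.
  have := @is_derive1_comp R expR (fun t => - (t * c)) t _ _ (is_derive_expR _) dc.
  by move/is_deriveN; rewrite mulrN opprK mulrC.
have cF : continuous F.
  move=> t; apply: differentiable_continuous; apply/derivable1_diffP.
  exact: (@ex_derive _ _ _ _ _ _ _ (dF t)).
rewrite (@ge0_continuous_FTC2y _ _ F _ 0)//.
- by rewrite /F mul1r sub0e EFinN oppeK.
- by move=> t _; rewrite mulr_ge0 ?expR_ge0// ltW.
- apply: continuous_subspaceT => t.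
  apply: cvgMr.
  rewrite (_ : (fun t => expR (- (t * c))) = \- F); last first.
    by apply/funext => y; rewrite /F/= opprK.
  rewrite (_ : expR _ = - F t); last by rewrite /F opprK.
  by apply: cvgN; exact: cF.
- rewrite -oppr0; apply: cvgN.
  apply: (@cvg_comp _ _ _ (fun t : R => t * c) (fun z => expR (- z)) _
    (pinfty_nbhs R)); last exact: cvgr_expR.
  exact: gt0_cvgMly.
- by apply: cvg_at_right_filter; exact: cF.
- by move=> t _; rewrite derive1E; exact: (@derive_val _ _ _ _ _ _ _ (dF t)).
Qed.

(* Tonelli on [exp(-x/2) = int_1^oo (x/2) exp(-t x/2) dt] replaces the
   integration by parts. *)
Lemma gamma_mass_rec (b : R) : 0 < b ->
  gamma_mass b = ((2 * b)%:E * gamma_mass (b - 1))%E.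
Proof.
move=> b0.
(* On [t >= 1] and [x > 0] this is [x^b exp(-t x/2) / 2]. Integrating [t] out leaves
   [x^(b-1) exp(-x/2)]; integrating [x] out leaves [t^(-(b+1)) / 2] times [gamma_mass b], whose
   integral over [t] contributes [1/(2b)]. *)
pose f (z : R * R) : \bar R :=
  (if 1 <= z.2 then 2^-1 * gamma_kernel b z.2 z.1 else 0)%:E.
have mf : measurable_fun setT f.
  apply/measurable_EFinP; apply: measurable_fun_ifT => //.
    exact: measurable_fun_ler.
  apply: measurable_funM => //.
  apply: (@measurableT_comp _ _ _ _ _ _
    (fun z : R * R => gamma_kernel b z.1 z.2) _ (fun z => (z.2, z.1))
    (measurable_gamma_kernel2 b)).
  exact: measurable_fun_pair.
have f0 z : (0 <= f z)%E.
  by rewrite /f; case: ifP => _; rewrite lee_fin// mulr_ge0// gamma_kernel_ge0.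
have itvE (g : R -> R) : (\int[mu]_(t in `[1%R, +oo[) (g t)%:E =
    \int[mu]_t (if 1 <= t then g t else 0)%:E)%E.
  rewrite integral_mkcond; apply: eq_integral => t _.
  rewrite patchE; case: ifPn => [|].
    by rewrite inE/= in_itv/= andbT => ->.
  by rewrite notin_setE/= in_itv/= andbT => /negP/negbTE ->.
have intx : (\int[mu]_x \int[mu]_t f (x, t) = gamma_mass (b - 1))%E.
  apply: eq_integral => x _; rewrite -itvE/=.
  rewrite /gamma_kernel; case: ifPn => x0; last first.
    by under eq_integral do rewrite mulr0; rewrite integral0.
  have xb : x `^ b = x `^ (b - 1) * x.
    rewrite -[X in _ = _ * X](powRr1 (ltW x0)) -powRD ?(gt_eqF x0) ?implybT//.
    by rewrite subrK.
  under eq_integral => t _.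
    rewrite (_ : 2^-1 * _ =
       x `^ (b - 1) * (x / 2 * expR (- (t * (x / 2))))); last first.
      have -> : - (t * x) / 2 = - (t * (x / 2)) by rewrite mulrA mulNr.
      by rewrite xb; ring.
    rewrite EFinM; over.
  rewrite ge0_integralZl//; last 3 first.
  - apply/measurable_EFinP; apply: measurable_funTS.
    apply: measurable_funM => //.
    apply: (@measurableT_comp _ _ _ _ _ _ (@expR R)) => //.
    by apply: measurableT_comp => //; apply: measurable_funM.
  - by move=> t _; rewrite lee_fin !mulr_ge0 ?expR_ge0 ?ltW// invr_gt0.
  - by rewrite lee_fin powR_ge0.
  by rewrite integral_expR_tail ?divr_gt0// -EFinM mul1r mulNr.
have intt : (\int[mu]_t \int[mu]_x f (x, t) = (2^-1 * b^-1)%:E * gamma_mass b)%E.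
  transitivity (\int[mu]_t ((if (1 <= t)%R then 2^-1 * t `^ (- (b + 1)) else 0)%:E * gamma_mass b))%E.
    apply: eq_integral => t _; rewrite /f/=; case: ifPn => t1; last first.
      by rewrite integral0 mul0e.
    under eq_integral do rewrite EFinM.
    rewrite ge0_integralZl//; last 2 first.
    - by apply/measurable_EFinP; exact: measurable_gamma_kernel.
    - by move=> x _; rewrite lee_fin gamma_kernel_ge0.
    by rewrite integral_gamma_kernel ?(lt_le_trans _ t1)// muleA -EFinM.
  have mp : measurable_fun [set: R] (fun t => t `^ (- (b + 1))) by exact: measurable_powR.
  rewrite ge0_integralZr//; last 3 first.
  - apply/measurable_EFinP; apply: measurable_fun_ifT => //.
      exact: measurable_fun_ler.
    exact: measurable_funM.
  - by move=> t _; rewrite lee_fin; case: ifP => // _; rewrite mulr_ge0 ?powR_ge0.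
  - exact: gamma_mass_ge0.
  rewrite -itvE; congr (_ * _)%E.
  under eq_integral do rewrite EFinM.
  rewrite ge0_integralZl//; last 2 first.
  - by apply/measurable_EFinP; exact: measurable_funTS.
  - by move=> t _; rewrite lee_fin powR_ge0.
  by rewrite integral_powR_tail// -EFinM.
have := @fubini_tonelli _ _ (measurableTypeR R) (measurableTypeR R) R mu mu
  f mf f0.
rewrite intt intx => ->; rewrite muleA -EFinM.
by rewrite mulrACA divff// mul1r divff ?gt_eqF// mul1e.
Qed.

End gamma_recurrence.

(* A named copy: inference on [mu \x mu] only finds the sigma-finiteness of
   products of subprobabilities. *)
Section lebesgue_square.
Context {R : realType}.
Local Notation mu := (@lebesgue_measure R).

Definition lebesgue_square :
    set (measurableTypeR R * measurableTypeR R)%type -> \bar R := (mu \x mu)%E.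

HB.instance Definition _ := Measure.on lebesgue_square.

Let lebesgue_square_sigma_finite : sigma_finite setT lebesgue_square.
Proof.
have /sigma_finiteP[F [TF ndF Foo]] := sigma_finiteT mu.
exists (fun n => F n `*` F n).
  rewrite -setXTT TF predeqE => -[x y]; split.
    move=> [/= [n _ Fnx] [k _ Gky]]; exists (maxn n k) => //; split.
    - by move: x Fnx; exact/subsetPset/ndF/leq_maxl.
    - by move: y Gky; exact/subsetPset/ndF/leq_maxr.
  by move=> [n _ []/= ? ?]; split; exists n.
move=> k; have [? ?] := Foo k.
split; first exact: measurableX.
by rewrite [X in (X < _)%E]product_measure1E// lte_mul_pinfty// ge0_fin_numE.
Qed.

HB.instance Definition _ := Measure_isSigmaFinite.Build _ _ _ lebesgue_square
  lebesgue_square_sigma_finite.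

End lebesgue_square.

(** * Chi-square densities *)

Section chi2_law.
Context {R : realType}.
Local Notation mu := (@lebesgue_measure R).

Definition chi2_norm (m : nat) : R := 2 `^ (m%:R / 2) * Gamma (m%:R / 2).

(** Nonnegativity suffices at this stage; the nondegeneracy of the normalisation is extracted later,
    in [ratio_mass_total], from the total mass of [P]. *)
Lemma chi2_norm_ge0 m : 0 <= chi2_norm m.
Proof.
rewrite mulr_ge0 ?powR_ge0//; apply: Rintegral_ge0 => x _.
by rewrite mulr_ge0 ?powR_ge0 ?expR_ge0.
Qed.

Lemma chi2_pdfE m (x : R) :
  chi2_pdf m x = (chi2_norm m)^-1 * gamma_kernel (m%:R / 2 - 1) 1 x.
Proof.
rewrite /chi2_pdf /gamma_kernel; case: ifPn => _; last by rewrite mulr0.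
by rewrite mulrC mul1r.
Qed.

Lemma chi2_pdf_ge0 m (x : R) : 0 <= chi2_pdf m x.
Proof. by rewrite chi2_pdfE mulr_ge0 ?invr_ge0 ?chi2_norm_ge0 ?gamma_kernel_ge0. Qed.

Lemma measurable_chi2_pdf m : measurable_fun [set: R] (@chi2_pdf R m).
Proof.
rewrite (_ : @chi2_pdf R m = fun x =>
  (chi2_norm m)^-1 * gamma_kernel (m%:R / 2 - 1) 1 x); last first.
  by apply/funext => x; exact: chi2_pdfE.
by apply: measurable_funM => //; exact: measurable_gamma_kernel.
Qed.

End chi2_law.

(** * Expectations under the scale mixture *)

Section mixture_law.
Context {R : realType} {d : measure_display} {T : measurableType d}.
Variables (m1 m2 : nat) (Pi : probability R R) (P : probability T R).
Variables (S1 S2 : {mfun T >-> R}) (s1 s2 : R).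
Local Notation mu := (@lebesgue_measure R).
Hypothesis law : forall C1 C2 : set R, measurable C1 -> measurable C2 ->
  P [set w | C1 (S1 w) /\ C2 (S2 w)] =
  (\int[Pi]_(t in `]0%R, +oo[) (scaled_chi2_prob (s1 / t) m1 C1 *
    scaled_chi2_prob (s2 / t) m2 C2))%E.

(** Joint density of [tau] and two unscaled chi-square variables with respect to [Pi] times planar
    Lebesgue measure. Its image [nu] under the rescaling [Phi] is the candidate law of
    [(S1, S2)]. *)
Let k (z : R * (measurableTypeR R * measurableTypeR R)) : R :=
  (if 0 < z.1 then 1 else 0) * (chi2_pdf m1 z.2.1 * chi2_pdf m2 z.2.2).

Let k0 z : 0 <= k z.
Proof. by rewrite mulr_ge0 ?mulr_ge0 ?chi2_pdf_ge0//; case: ifP. Qed.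

Let mk : measurable_fun setT k.
Proof.
apply: measurable_funM.
  by apply: measurable_fun_ifT => //; exact: measurable_fun_ltr.
apply: measurable_funM.
  apply: (@measurableT_comp _ _ _ _ _ _ (@chi2_pdf R m1) _ (fun z => z.2.1)).
    exact: measurable_chi2_pdf.
  exact: measurableT_comp.
apply: (@measurableT_comp _ _ _ _ _ _ (@chi2_pdf R m2) _ (fun z => z.2.2)).
  exact: measurable_chi2_pdf.
exact: measurableT_comp.
Qed.

Let kmf : {mfun (R * (measurableTypeR R * measurableTypeR R))%type >-> R} :=
  HB.pack k (isMeasurableFun.Build _ _ _ _ _ mk).

Let Phi (z : R * (measurableTypeR R * measurableTypeR R)) : R * R :=
  (s1 / z.1 * z.2.1, s2 / z.1 * z.2.2).

Let mPhi : measurable_fun setT Phi.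
Proof.
have mi : measurable_fun setT
    (fun z : R * (measurableTypeR R * measurableTypeR R) => z.1^-1).
  exact: (@measurableT_comp _ _ _ _ _ _ (@GRing.inv R) _ fst measurable_invr).
apply: measurable_fun_pair; apply: measurable_funM.
- exact: measurable_funM.
- exact: (@measurableT_comp _ _ _ _ _ _ fst).
- exact: measurable_funM.
- exact: (@measurableT_comp _ _ _ _ _ _ snd).
Qed.

Let mu3 : {measure set (R * (measurableTypeR R * measurableTypeR R))%type
    -> \bar R} := (Pi \x lebesgue_square)%E.

Let nu : {measure set (R * R)%type -> \bar R} :=
  image_measure (density mu3 (f := kmf) k0) mPhi.

Let mS : measurable_fun setT (fun w => (S1 w, S2 w)).
Proof. exact: measurable_fun_pair. Qed.

Let integral_nu (h : R * R -> R) : measurable_fun setT h -> (forall z, 0 <= h z) ->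
  (\int[nu]_z (h z)%:E = \int[Pi]_(t in `]0%R, +oo[) \int[mu]_x \int[mu]_y
    (h (s1 / t * x, s2 / t * y)%R * (chi2_pdf m1 x * chi2_pdf m2 y))%:E)%E.
Proof.
move=> mh h0.
have mhP : measurable_fun setT (h \o Phi) by exact: measurableT_comp.
rewrite ge0_integral_pushforward//; last 2 first.
- exact/measurable_EFinP.
- by move=> z _; rewrite lee_fin.
rewrite preimage_setT ge0_integral_density//=; last 2 first.
- exact/measurable_EFinP.
- by move=> z; rewrite lee_fin.
pose g (z : R * (measurableTypeR R * measurableTypeR R)) : \bar R :=
  ((h (Phi z))%:E * (k z)%:E)%E.
have mg : measurable_fun setT g.
  by apply: emeasurable_funM; exact/measurable_EFinP.
have g0 z : (0 <= g z)%E by rewrite mule_ge0 ?lee_fin.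
rewrite (@fubini_tonelli1 _ _ _ _ R Pi lebesgue_square g)//.
rewrite [in RHS]integral_mkcond; apply: eq_integral => t _.
rewrite /fubini_F patchE.
have mgt : measurable_fun setT (fun z => g (t, z)).
  by apply: measurableT_comp.
rewrite (@fubini_tonelli1 _ _ _ _ R mu mu (fun z => g (t, z)))//.
case: ifPn => t0.
  apply: eq_integral => x _; apply: eq_integral => y _.
  move: t0; rewrite inE/= in_itv/= andbT => t0.
  by rewrite /g /k /Phi/= t0 mul1r -EFinM.
move: t0; rewrite notin_setE/= in_itv/= andbT => /negP/negbTE t0.
rewrite integral0_eq// => x _; rewrite /fubini_F integral0_eq// => y _.
by rewrite /g /k/= t0 mul0r mule0.
Qed.

(** The hypothesis [law] speaks of rectangles only. They are stable under intersection and generate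
    the product sigma-algebra, so the finite image law of [(S1, S2)] coincides with [nu], and
    integrals of nonnegative functions follow. *)
Lemma integral_mixture (h : R * R -> R) :
  measurable_fun setT h -> (forall z, 0 <= h z) ->
  (\int[P]_w (h (S1 w, S2 w))%:E =
   \int[Pi]_(t in `]0%R, +oo[) \int[mu]_x \int[mu]_y
    (h (s1 / t * x, s2 / t * y)%R * (chi2_pdf m1 x * chi2_pdf m2 y))%:E)%E.
Proof.
move=> mh h0; rewrite -integral_nu//.
transitivity (\int[image_measure P mS]_z (h z)%:E)%E.
  rewrite ge0_integral_pushforward//; first exact/measurable_EFinP.
  by move=> z _; rewrite lee_fin.
apply: eq_measure_integral => A mA _.
pose G : set (set (R * R)) :=
  [set C | exists A, measurable A /\ exists B, measurable B /\ C = A `*` B].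
apply: (measure_unique G (fun=> setT)) => //.
- rewrite measurable_prod_measurableType //; congr (<<s _ >>).
  rewrite predeqE; split => [[B mB [C mC <-]]|[B [mB [C [mC ->]]]]].
    by exists B; split => //; exists C.
  by exists B => //; exists C.
- move=> _ _ [X1 [mX1 [X2 [mX2 ->]]]] [Y1 [mY1 [Y2 [mY2 ->]]]].
  rewrite -setXI; exists (X1 `&` Y1); split; first exact: measurableI.
  by exists (X2 `&` Y2); split => //; exact: measurableI.
- by move=> _; exists setT; split => //; exists setT; split => //; rewrite setXTT.
- by rewrite bigcup_const.
- move=> _ [C1 [mC1 [C2 [mC2 ->]]]].
  have mCC : measurable (C1 `*` C2) by exact: measurableX.
  rewrite [LHS](law mC1 mC2).
  transitivity (\int[nu]_z (\1_(C1 `*` C2) z)%:E)%E; last first.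
    by rewrite integral_indic// setIT.
  rewrite integral_nu//; apply: eq_integral => t _.
  have mC (c : R) m (C : set R) : measurable C ->
      measurable_fun setT (fun x => \1_C (c * x) * chi2_pdf m x : R).
    move=> mC; apply: measurable_funM; last exact: measurable_chi2_pdf.
    have mi : measurable_fun setT (\1_C : R -> R) by exact: measurable_indic.
    have mc : measurable_fun [set: R] ( *%R c) by exact: measurable_funM.
    exact: (measurableT_comp mi mc).
  have chi2E (c : R) m (C : set R) : measurable C ->
      (scaled_chi2_prob c m C = \int[mu]_x (\1_C (c * x)%R * chi2_pdf m x)%:E)%E.
    move=> mC'; rewrite /scaled_chi2_prob /chi2_prob integral_mkcond.
    apply: eq_integral => x _; rewrite patchE indicE.
    rewrite (_ : (x \in [set x0 | C (c * x0)]) = (c * x \in C)); last first.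
      by apply/idP/idP; rewrite !inE.
    by case: ifP => _; rewrite ?mul1r ?mul0r.
  rewrite !chi2E// -ge0_integralZr//; last 3 first.
  - by apply/measurable_EFinP; exact: mC.
  - by move=> x _; rewrite lee_fin mulr_ge0 ?chi2_pdf_ge0.
  - by apply: integral_ge0 => x _; rewrite lee_fin mulr_ge0 ?chi2_pdf_ge0.
  apply: eq_integral => x _; rewrite -ge0_integralZl//; last 3 first.
  - by apply/measurable_EFinP; exact: mC.
  - by move=> y _; rewrite lee_fin mulr_ge0 ?chi2_pdf_ge0.
  - by rewrite lee_fin mulr_ge0 ?chi2_pdf_ge0.
  apply: eq_integral => y _; rewrite -EFinM !indicE in_setX/= -mulnb natrM.
  by rewrite mulrACA.
- by move=> _; rewrite /= /pushforward preimage_setT probability_setT ltry.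
Qed.

End mixture_law.

(** * The ratio of two independent gamma variables *)

Section chi2_ratio.
Context {R : realType}.
Local Notation mu := (@lebesgue_measure R).

(** An unnormalised beta-prime density. *)
Definition beta_kernel (b c w : R) : R :=
  if 0 < w then w `^ b * (1 + w) `^ (- c) else 0.

Lemma beta_kernel_ge0 b c w : 0 <= beta_kernel b c w.
Proof. by rewrite /beta_kernel; case: ifP => // _; rewrite mulr_ge0 ?powR_ge0. Qed.

Lemma measurable_beta_kernel b c : measurable_fun [set: R] (beta_kernel b c).
Proof.
apply: measurable_fun_ifT => //; first exact: measurable_fun_ltr.
apply: measurable_funM; first exact: measurable_powR.
apply: (measurableT_comp (@measurable_powR R _)).
exact: measurable_funD.
Qed.

(** The substitution [y = x w], with Jacobian [x], turns the product of kernels into [w^b] times a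
    gamma kernel in [x] of exponent [a + b + 1] and rate [1 + w]. Integrating [x] out produces the
    power [(1 + w)^(-(a+b+2))]. *)
Lemma integral_gamma_ratio (a b : R) (q : R -> R) :
  measurable_fun setT q -> (forall x, 0 <= q x) ->
  (\int[mu]_x \int[mu]_y
     (q (y / x)%R * (gamma_kernel a 1 x * gamma_kernel b 1 y))%:E =
   gamma_mass (a + b + 1) *
   \int[mu]_w (q w * beta_kernel b (a + b + 2) w)%:E)%E.
Proof.
move=> mq q0.
pose p (w : R) := if 0 < w then w `^ b else 0.
have p0 w : 0 <= p w by rewrite /p; case: ifP => // _; exact: powR_ge0.
have mp : measurable_fun setT p.
  apply: measurable_fun_ifT => //; exact: measurable_fun_ltr.
pose f (z : R * R) : \bar R :=
  (q z.2 * p z.2 * gamma_kernel (a + b + 1) (1 + z.2) z.1)%:E.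
have mf : measurable_fun setT f.
  apply/measurable_EFinP; apply: measurable_funM.
    by apply: measurable_funM; exact: measurableT_comp.
  apply: (@measurableT_comp _ _ _ _ _ _
    (fun z : R * R => gamma_kernel (a + b + 1) z.1 z.2) _
    (fun z : R * R => (1 + z.2, z.1)) (measurable_gamma_kernel2 (a + b + 1))).
  by apply: measurable_fun_pair => //; exact: measurable_funD.
have f0 z : (0 <= f z)%E by rewrite lee_fin !mulr_ge0// gamma_kernel_ge0.
transitivity (\int[mu]_x \int[mu]_w f (x, w))%E.
  apply: eq_integral => x _; have [x0|x0] := ltP 0 x; last first.
    rewrite !integral0_eq// => w _; rewrite /f /gamma_kernel/= ltNge x0/=.
      by rewrite mulr0.
    by rewrite mul0r mulr0.
  rewrite (ge0_integral_scale x0); last 2 first.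
  - apply/measurable_EFinP; apply: measurable_funM.
      apply: (measurableT_comp mq); exact: measurable_funM.
    by apply: measurable_funM => //; exact: measurable_gamma_kernel.
  - by move=> w; rewrite lee_fin !mulr_ge0 ?gamma_kernel_ge0.
  rewrite -ge0_integralZl//; last 3 first.
  - apply/measurable_EFinP; apply: measurable_funM.
      apply: (measurableT_comp mq).
      by apply: measurable_funM => //; exact: measurable_funM.
    apply: measurable_funM => //.
    apply: (measurableT_comp (measurable_gamma_kernel b 1)).
    exact: measurable_funM.
  - by move=> w _; rewrite lee_fin !mulr_ge0 ?gamma_kernel_ge0.
  - by rewrite lee_fin ltW.
  apply: eq_integral => w _; rewrite /f/= -EFinM; congr EFin.
  rewrite mulrAC divff ?gt_eqF// mul1r /p /gamma_kernel x0 pmulr_rgt0//.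
  case: ifPn => w0; last by rewrite !mulr0 mul0r.
  rewrite powRM ?ltW// !powRD ?(gt_eqF x0) ?implybT// powRr1 ?ltW//.
  rewrite (_ : - ((1 + w) * x) / 2 = - (1 * x) / 2 + - (1 * (x * w)) / 2); last by ring.
  by rewrite expRD; ring.
have := @fubini_tonelli _ _ (measurableTypeR R) (measurableTypeR R) R mu mu
  f mf f0.
move=> ->; rewrite -ge0_integralZl//; last 3 first.
- apply/measurable_EFinP; apply: measurable_funM => //.
  exact: measurable_beta_kernel.
- by move=> w _; rewrite lee_fin mulr_ge0 ?beta_kernel_ge0.
- exact: gamma_mass_ge0.
apply: eq_integral => w _; rewrite /f/=.
have [w0|w0] := ltP 0 w; last first.
  rewrite /p /beta_kernel ltNge w0/= mulr0 mule0.
  by under eq_integral do rewrite mul0r; rewrite integral0.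
under eq_integral do rewrite EFinM.
rewrite ge0_integralZl//; last 3 first.
- by apply/measurable_EFinP; exact: measurable_gamma_kernel.
- by move=> x _; rewrite lee_fin gamma_kernel_ge0.
- by rewrite lee_fin mulr_ge0.
rewrite integral_gamma_kernel ?addr_gt0// muleA muleC -EFinM; congr (_ * _%:E)%E.
by rewrite /p /beta_kernel w0 mulrA (_ : a + b + 1 + 1 = a + b + 2)//; ring.
Qed.

End chi2_ratio.

(** * Weighted expectations of functions of the ratio *)

Section mixture_ratio.
Context {R : realType} {d : measure_display} {T : measurableType d}.
Variables (m1 m2 : nat) (Pi : probability R R) (P : probability T R).
Variables (S1 S2 : {mfun T >-> R}) (s1 s2 : R).
Local Notation mu := (@lebesgue_measure R).
Hypothesis law : forall C1 C2 : set R, measurable C1 -> measurable C2 ->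
  P [set w | C1 (S1 w) /\ C2 (S2 w)] =
  (\int[Pi]_(t in `]0%R, +oo[) (scaled_chi2_prob (s1 / t) m1 C1 *
    scaled_chi2_prob (s2 / t) m2 C2))%E.
Hypothesis s1_gt0 : 0 < s1.

(** At [tau = t] one has [V = x / t] and [Z = (s2 / s1) (y / x)]. The mixing variable cancels in [Z]
    and factors out of [V^j], while [x^j] raises the first gamma exponent by [j]. The values [j = 0]
    and [j = 1] give the two quantities to compare. *)
Lemma integral_mixture_ratio (j : nat) (q : R -> R) :
  measurable_fun setT q -> (forall x, 0 <= q x) ->
  (\int[P]_w (if (0 < S1 w)%R then (S1 w / s1) ^+ j * q (S2 w / S1 w) else 0)%:E =
   (\int[Pi]_(t in `]0%R, +oo[) (t^-1 ^+ j)%:E) *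
   ((((chi2_norm m1)^-1 / chi2_norm m2)%:E *
     gamma_mass ((m1 + m2)%:R / 2 - 1 + j%:R)) *
    \int[mu]_w (q (s2 / s1 * w)%R *
      beta_kernel (m2%:R / 2 - 1) ((m1 + m2)%:R / 2 + j%:R) w)%:E))%E.
Proof.
move=> mq q0.
pose h (z : R * R) := if 0 < z.1 then (z.1 / s1) ^+ j * q (z.2 / z.1) else 0.
have h0 z : 0 <= h z.
  by rewrite /h; case: ifPn => // z0; rewrite mulr_ge0// exprn_ge0// divr_ge0 ?ltW.
have mh : measurable_fun setT h.
  apply: measurable_fun_ifT => //; first exact: measurable_fun_ltr.
  apply: measurable_funM.
    by apply: measurable_funX; exact: measurable_funM.
  apply: (measurableT_comp mq); apply: measurable_funM => //.
  exact: (@measurableT_comp _ _ _ _ _ _ (@GRing.inv R) _ fst measurable_invr).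
have := integral_mixture law mh h0; rewrite /h/= => ->.
set K := (chi2_norm m1)^-1 / chi2_norm m2.
have K0 : 0 <= K by rewrite divr_ge0 ?invr_ge0 ?chi2_norm_ge0.
pose q' w := q (s2 / s1 * w).
have mq' : measurable_fun setT q'.
  by apply: (measurableT_comp mq); exact: measurable_funM.
set a : R := m1%:R / 2 - 1 + j%:R; set b : R := m2%:R / 2 - 1.
pose G := (\int[mu]_x \int[mu]_y
     (q' (y / x)%R * (gamma_kernel a 1 x * gamma_kernel b 1 y))%:E)%E.
have G0 : (0 <= G)%E.
  apply: integral_ge0 => x _; apply: integral_ge0 => y _.
  by rewrite lee_fin /q' !mulr_ge0 ?gamma_kernel_ge0.
pose g (z : R * R) : \bar R :=
  (q' (z.2 / z.1) * (gamma_kernel a 1 z.1 * gamma_kernel b 1 z.2))%:E.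
have g0 z : (0 <= g z)%E by rewrite lee_fin /q' !mulr_ge0 ?gamma_kernel_ge0.
have mg : measurable_fun setT g.
  apply/measurable_EFinP; apply: measurable_funM.
    apply: (measurableT_comp mq'); apply: measurable_funM => //.
    exact: (@measurableT_comp _ _ _ _ _ _ (@GRing.inv R) _ fst measurable_invr).
  apply: measurable_funM.
    exact: (@measurableT_comp _ _ _ _ _ _ _ _ fst (measurable_gamma_kernel a 1)).
  exact: (@measurableT_comp _ _ _ _ _ _ _ _ snd (measurable_gamma_kernel b 1)).
transitivity (\int[Pi]_(t in `]0%R, +oo[) ((t^-1 ^+ j)%:E * (K%:E * G)))%E.
  apply: eq_integral => t; rewrite inE/= in_itv/= andbT => t0.
  have tj : 0 <= (t^-1) ^+ j by rewrite exprn_ge0// invr_ge0 ltW.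
  rewrite muleA -EFinM /G -ge0_integralZl//; last 3 first.
  - exact: (@measurable_fun_fubini_tonelli_F _ _ (measurableTypeR R)
      (measurableTypeR R) R mu g mg g0).
  - move=> x _; apply: integral_ge0 => y _.
    by rewrite lee_fin /q' !mulr_ge0 ?gamma_kernel_ge0.
  - by rewrite lee_fin mulr_ge0.
  apply: eq_integral => x _.
  rewrite -ge0_integralZl//; last 3 first.
  - apply/measurable_EFinP; apply: measurable_funM.
      by apply: (measurableT_comp mq'); exact: measurable_funM.
    by apply: measurable_funM => //; exact: measurable_gamma_kernel.
  - by move=> y _; rewrite lee_fin /q' !mulr_ge0 ?gamma_kernel_ge0.
  - by rewrite lee_fin mulr_ge0.
  apply: eq_integral => y _; rewrite -EFinM; congr EFin.
  rewrite pmulr_rgt0 ?divr_gt0// !chi2_pdfE -/b /K /q'.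
  case: ifPn => x0; last first.
    by rewrite mul0r /gamma_kernel (negbTE x0) mul0r !mulr0.
  have -> : s2 / t * y / (s1 / t * x) = s2 / s1 * (y / x).
    by field; rewrite !gt_eqF.
  have -> : s1 / t * x / s1 = t^-1 * x by field; rewrite !gt_eqF.
  have -> : gamma_kernel a 1 x = x ^+ j * gamma_kernel (m1%:R / 2 - 1) 1 x.
    rewrite /gamma_kernel x0 /a powRD ?(gt_eqF x0) ?implybT// powR_mulrn ?ltW//.
    by rewrite mulrCA mulrA.
  by rewrite exprMn; ring.
rewrite ge0_integralZr//; last 3 first.
- apply/measurable_EFinP; apply: measurable_funTS.
  by apply: measurable_funX; exact: measurable_invr.
- move=> t; rewrite /= in_itv/= andbT => t0.
  by rewrite lee_fin exprn_ge0// invr_ge0 ltW.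
- by rewrite mule_ge0.
rewrite /G integral_gamma_ratio//; last by move=> x; exact: q0.
rewrite (muleA K%:E).
have -> : a + b + 1 = (m1 + m2)%:R / 2 - 1 + j%:R by rewrite /a /b natrD; ring.
have -> // : a + b + 2 = (m1 + m2)%:R / 2 + j%:R.
by rewrite /a /b natrD; ring.
Qed.

End mixture_ratio.

Lemma integral_positive_gt0 (d : measure_display) (T : measurableType d)
    (R : realType) (m : {measure set T -> \bar R}) (D : set T) (f : T -> \bar R) :
  measurable D -> measurable_fun D f -> (forall x, D x -> 0 < f x)%E ->
  m D != 0%E -> (0 < \int[m]_(x in D) f x)%E.
Proof.
move=> mD mf f0 mD0; rewrite lt0e integral_ge0 ?andbT; last first.
  by move=> x Dx; exact/ltW/f0.
apply: contra mD0 => /eqP intf0; apply/eqP.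
have /ae_eq_integral_abs : (\int[m]_(x in D) `|f x| = 0)%E.
  rewrite -intf0; apply: eq_integral => x; rewrite inE => Dx.
  by rewrite gee0_abs// ltW// f0.
move=> /(_ mD mf) aef.
have /negligibleP : m.-negligible D.
  apply: negligibleS aef => x Dx /= /(_ Dx) fx0.
  by have := f0 _ Dx; rewrite fx0 ltxx.
exact.
Qed.

(** * Comparison of the truncated beta integrals *)

Section order_beta.
Context {R : realType}.
Variables (m1 m2 : nat) (Pi : probability R R) (phi : R -> R).
Local Notation mu := (@lebesgue_measure R).
Local Notation M := ((m1 + m2)%:R : R).
Local Notation g0 := (beta_kernel (m2%:R / 2 - 1) (M / 2)).
Local Notation g1 := (beta_kernel (m2%:R / 2 - 1) (M / 2 + 1)).
Hypotheses (M_gt0 : 0 < M) (mi_gt0 : 0 < mean_inv Pi).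
Hypothesis g0_fin : (\int[mu]_w (g0 w)%:E < +oo)%E.
Hypothesis phi_nd : forall u v : R, 0 < u -> u <= v -> phi u <= phi v.
Hypothesis phi_ge : forall u : R, 0 < u -> lower_bound m1 m2 Pi u <= phi u.

Lemma beta_kernelS_le (b c w : R) : beta_kernel b (c + 1) w <= beta_kernel b c w.
Proof.
rewrite /beta_kernel; case: ifPn => // w0; apply: ler_wpM2l; first exact: powR_ge0.
apply: ler_powR; first by rewrite lerDl ltW.
by rewrite lerN2 lerDl.
Qed.

Lemma integral_beta_itv_fin b c u : (\int[mu]_w (beta_kernel b c w)%:E < +oo)%E ->
  (\int[mu]_(w in `]0%R, u[) (beta_kernel b c w)%:E)%E \is a fin_num.
Proof.
move=> fin; rewrite ge0_fin_numE; last first.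
  by apply: integral_ge0 => w _; rewrite lee_fin beta_kernel_ge0.
apply: le_lt_trans fin; apply: ge0_subset_integral => //.
- by apply/measurable_EFinP; exact: measurable_beta_kernel.
- by move=> w _; rewrite lee_fin beta_kernel_ge0.
Qed.

Lemma integral_beta_kernelS_lty : (\int[mu]_w (g1 w)%:E < +oo)%E.
Proof.
apply: le_lt_trans g0_fin; apply: ge0_le_integral => //.
- by move=> w _; rewrite lee_fin beta_kernel_ge0.
- by apply/measurable_EFinP; exact: measurable_beta_kernel.
- by apply/measurable_EFinP; exact: measurable_beta_kernel.
- by move=> w _; rewrite lee_fin beta_kernelS_le.
Qed.

Lemma integral_beta_itv_gt0 b c u : 0 < u ->
  (0 < \int[mu]_(w in `]0%R, u[) (beta_kernel b c w)%:E)%E.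
Proof.
move=> u0; apply: integral_positive_gt0 => //.
- by apply/measurable_EFinP/measurable_funTS; exact: measurable_beta_kernel.
- move=> w; rewrite /= in_itv/= => /andP[w0 _].
  by rewrite lte_fin /beta_kernel w0 mulr_gt0 ?powR_gt0 ?addr_gt0.
- by rewrite /= lebesgue_measure_itv/= lte_fin u0 -EFinB subr0 gt_eqF.
Qed.

Lemma lower_boundE u :
  lower_bound m1 m2 Pi u = 1 / M *
    (fine (\int[mu]_(w in `]0%R, u[) (g0 w)%:E)%E /
     (mean_inv Pi * fine (\int[mu]_(w in `]0%R, u[) (g1 w)%:E)%E)).
Proof.
have E (c : R) : \int[mu]_(t in `]0, u[) (t `^ (m2%:R / 2 - 1) * (1 + t) `^ (- c)) =
   fine (\int[mu]_(w in `]0%R, u[) (beta_kernel (m2%:R / 2 - 1) c w)%:E)%E.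
  congr fine; apply: eq_integral => t; rewrite inE/= in_itv/= => /andP[t0 _].
  by rewrite /beta_kernel t0.
by rewrite /lower_bound !E.
Qed.

(** Condition (ii) with its denominators cleared, which uses that the integral of [g1] is positive
    and finite. Equality [phi u = c] is allowed because the strict comparison applies this with
    [c = phi v]. *)
Lemma integral_beta_itv_le u c : 0 < u -> phi u <= c ->
  (\int[mu]_(w in `]0%R, u[) (g0 w)%:E <=
   (c * mean_inv Pi * M)%:E * \int[mu]_(w in `]0%R, u[) (g1 w)%:E)%E.
Proof.
move=> u0 uc; have := le_trans (phi_ge u0) uc.
rewrite lower_boundE => lb.
have fin0 := integral_beta_itv_fin u g0_fin.
have fin1 := integral_beta_itv_fin u integral_beta_kernelS_lty.
have gt1 := integral_beta_itv_gt0 (m2%:R / 2 - 1) (M / 2 + 1) u0.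
rewrite -(fineK fin0) -(fineK fin1) -EFinM lee_fin.
have {}gt1 : 0 < fine (\int[mu]_(w in `]0%R, u[) (g1 w)%:E)%E.
  by rewrite -lte_fin fineK.
move: lb; rewrite mulrA ler_pdivrMr ?mulr_gt0// mul1r mulrC ler_pdivrMr// => lb.
by apply: le_trans lb _; rewrite -subr_ge0 le_eqVlt; apply/orP; left; apply/eqP; ring.
Qed.

(** A real-valued indicator, to serve as the weight [q] above; it vanishes off [(0, +oo)], where
    nothing is known about [phi]. *)
Definition below (c z : R) : R := ((0 < z) && (phi z < c))%:R.

Lemma below_ge0 c z : 0 <= below c z. Proof. exact: ler0n. Qed.

(** By monotonicity the sublevel set is an initial interval of [(0, +oo)], bounded by [u / k], and
    [v] is its supremum. Nothing is claimed at [v] itself, where [phi (k * w)] may jump. *)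
Lemma below_threshold (k c : R) : 0 < k -> (exists2 u, 0 < u & c <= phi u) ->
  (exists2 w, 0 < w & phi (k * w) < c) ->
  exists v, [/\ 0 < v, forall w, 0 < w -> w < v -> phi (k * w) < c &
    forall w, v < w -> c <= phi (k * w)].
Proof.
move=> k0 [u u0 cu] [w w0 wc].
pose J := [set x : R | 0 < x /\ phi (k * x) < c].
have Jw : J w by [].
have ubJ : ubound J (u / k).
  move=> x [x0 xc]; rewrite ler_pdivlMr// leNgt; apply/negP => ux.
  by move: xc; rewrite ltNge (le_trans cu)// phi_nd// (le_trans (ltW ux))// mulrC.
have supJ : has_sup J by split; [exists w|exists (u / k)].
exists (sup J); split.
- by apply: lt_le_trans w0 _; exact: sup_upper_bound.
- move=> x x0 /(sup_gt (ex_intro _ _ Jw))[y [y0 yc] xy].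
  apply: le_lt_trans yc; apply: phi_nd; first by rewrite mulr_gt0.
  by rewrite ler_pM2l// ltW.
- move=> x xJ; rewrite leNgt; apply/negP => xc.
  have x0 : 0 < x by apply: lt_trans xJ; apply: lt_le_trans w0 _; exact: sup_upper_bound.
  have : J x by [].
  by move/(sup_upper_bound supJ)/(lt_le_trans xJ); rewrite ltxx.
Qed.

(** Monotonicity is the source of measurability: the set where [below c] is 1 is an interval. *)
Lemma measurable_below c : measurable_fun setT (below c).
Proof.
have -> : below c = \1_[set z | 0 < z /\ phi z < c].
  apply/funext => z; rewrite /below indicE; congr (_ _)%:R.
  by apply/idP/idP; rewrite inE => /andP.
apply: measurable_indic; apply: is_interval_measurable.
move=> x y [x0 xc] [y0 yc] z /andP[xz zy]; split; first exact: lt_le_trans xz.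
by apply: le_lt_trans yc; apply: phi_nd => //; exact: lt_le_trans xz.
Qed.

(** The two integrands can differ only at the single point [v]. *)
Lemma integral_below_itv (k c v b e : R) : 0 < k ->
  (forall w, 0 < w -> w < v -> phi (k * w) < c) ->
  (forall w, v < w -> c <= phi (k * w)) ->
  (\int[mu]_w (below c (k * w) * beta_kernel b e w)%:E =
   \int[mu]_(w in `]0%R, v[) (beta_kernel b e w)%:E)%E.
Proof.
move=> k0 lo hi; rewrite [RHS]integral_mkcond.
apply: ae_eq_integral => //.
- apply/measurable_EFinP; apply: measurable_funM; last exact: measurable_beta_kernel.
  by apply: (measurableT_comp (measurable_below c)); exact: measurable_funM.
- apply/(measurable_restrictT (EFin \o beta_kernel b e)) => //.
  by apply/measurable_EFinP/measurable_funTS; exact: measurable_beta_kernel.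
exists [set v]; split; [exact: measurable_set1|exact: lebesgue_measure_set1|].
move=> w /= /not_implyP[_]; apply: contra_notP => wv.
rewrite patchE /below pmulr_rgt0//; case: ifPn.
  rewrite inE/= in_itv/= => /andP[w0 ww]; by rewrite w0 lo// mul1r.
rewrite notin_setE/= in_itv/= => /negP; rewrite negb_and.
have [w0/=|w0 _] := ltP 0 w; last by rewrite mul0r.
rewrite -leNgt le_eqVlt => /orP[/eqP vw|vw]; first by rewrite vw in wv.
by rewrite ltNge hi// mul0r.
Qed.

(** For [k > 1] the endpoint satisfies [phi v < c], so (ii) at [v] already holds with the smaller
    constant [phi v]; replacing it by [c] is a strict increase because the integral of [g1] is
    positive. *)
Lemma integral_below_lt (k c : R) : 1 < k -> 0 < c ->
  (exists2 u, 0 < u & c <= phi u) -> (exists2 w, 0 < w & phi (k * w) < c) ->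
  (\int[mu]_w (below c (k * w) * g0 w)%:E <
   (c * mean_inv Pi * M)%:E * \int[mu]_w (below c (k * w) * g1 w)%:E)%E.
Proof.
move=> k1 c0 hc hw; have k0 : 0 < k by exact: lt_trans k1.
have [v [v0 lo hi]] := below_threshold k0 hc hw.
rewrite !(integral_below_itv _ _ k0 lo hi).
have pvc : phi v < c.
  (* The midpoint of [v / k] and [v] lies below [v], yet [k] times it exceeds [v]. *)
  have := lo (v * ((1 + k^-1) / 2)); rewrite gtr_pMr// pmulr_rgt0//.
  have ki : 0 < k^-1 by rewrite invr_gt0.
  have ki1 : k^-1 < 1 by rewrite invf_lt1.
  move=> /(_ ltac:(lra) ltac:(lra)); apply: le_lt_trans; apply: phi_nd => //.
  rewrite mulrCA ler_peMr ?ltW//.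
  have -> : k * ((1 + k^-1) / 2) = (k + 1) / 2 by field; rewrite gt_eqF.
  lra.
apply: le_lt_trans (integral_beta_itv_le v0 (lexx _)) _.
have fin1 := integral_beta_itv_fin v integral_beta_kernelS_lty.
have gt1 := integral_beta_itv_gt0 (m2%:R / 2 - 1) (M / 2 + 1) v0.
by rewrite lte_pmul2r// lte_fin !ltr_pM2r.
Qed.

(** When [k = 1] it may happen that [c <= phi v], so (ii) cannot be used at [v]. It is used at the
    points [v - 1/(n+1)], where [phi] is below [c], and monotone convergence reaches the full
    interval. *)
Lemma integral_below_le (k c : R) : 1 <= k -> 0 < c ->
  (exists2 u, 0 < u & c <= phi u) ->
  (\int[mu]_w (below c (k * w) * g0 w)%:E <=
   (c * mean_inv Pi * M)%:E * \int[mu]_w (below c (k * w) * g1 w)%:E)%E.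
Proof.
move=> k1 c0 hc; have k0 : 0 < k by exact: lt_le_trans k1.
have kap0 : (0 <= (c * mean_inv Pi * M)%:E)%E.
  by rewrite lee_fin !mulr_ge0// ltW.
have [hw|nhw] := pselect (exists2 w, 0 < w & phi (k * w) < c); last first.
  rewrite integral0_eq => [|w _].
    rewrite mule_ge0//; apply: integral_ge0 => w _.
    by rewrite lee_fin mulr_ge0 ?below_ge0 ?beta_kernel_ge0.
  rewrite /below pmulr_rgt0//; have [w0/=|w0] := ltP 0 w; last by rewrite mul0r.
  by have [wc|_] := ltP (phi (k * w)) c; [case: nhw; exists w|rewrite mul0r].
have [v [v0 lo hi]] := below_threshold k0 hc hw.
rewrite !(integral_below_itv _ _ k0 lo hi).
pose F (n : nat) : set R := `]0, v - n.+1%:R^-1[%classic.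
have ndF : nondecreasing_seq F.
  move=> m n mn; apply/subsetPset; apply: subset_itvl.
  by rewrite bnd_simp lerD2l lerN2 lef_pV2 ?posrE// ler_nat.
have UF : \bigcup_n F n = `]0, v[%classic.
  apply/seteqP; split => [w [n _]|w]; rewrite /F/= !in_itv/=.
    by move=> /andP[-> /=] wn; apply: lt_trans wn _; rewrite ltrBlDr ltrDl.
  move=> /andP[w0 wv]; have [n wn] := ltr_add_invr wv.
  by exists n => //=; rewrite in_itv/= w0/= ltrBrDr.
have mg (b e : R) D : measurable_fun D (fun w => (beta_kernel b e w)%:E).
  by apply/measurable_EFinP/measurable_funTS; exact: measurable_beta_kernel.
have mF n : measurable (F n) by exact: measurable_itv.
have cv : (\int[mu]_(w in F n) (g0 w)%:E @[n --> \oo] -->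
    \int[mu]_(w in `]0%R, v[) (g0 w)%:E)%E.
  rewrite -UF; apply: ge0_nondecreasing_set_cvg_integral => //; first by move=> n; exact: mg.
  by move=> n w _; rewrite lee_fin beta_kernel_ge0.
rewrite -(cvg_lim _ cv)//; apply: lime_le.
  by apply/cvg_ex; eexists; exact: cv.
near=> n.
have [v1|v1] := ltP 0 (v - n.+1%:R^-1); last first.
  rewrite /F set_itv_ge ?bnd_simp -?leNgt// integral_set0 mule_ge0//.
  by apply: integral_ge0 => w _; rewrite lee_fin beta_kernel_ge0.
have vv : v - n.+1%:R^-1 < v by rewrite ltrBlDr ltrDl.
apply: (@le_trans _ _ ((c * mean_inv Pi * M)%:E * \int[mu]_(w in F n) (g1 w)%:E)%E).
  apply: integral_beta_itv_le => //; apply: le_trans (ltW (lo _ v1 vv)).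
  by apply: phi_nd => //; rewrite ler_peMl// ltW.
apply: lee_wpmul2l => //; apply: ge0_subset_integral => //.
- exact: mF.
- exact: mg.
- by move=> w _; rewrite lee_fin beta_kernel_ge0.
- by rewrite -UF; exact: bigcup_sup.
Unshelve. all: end_near. Qed.

End order_beta.

Lemma mean_inv_fine (R : realType) (Pi : probability R R) :
  Pi.-integrable `]0, +oo[%classic (fun t : R => (t^-1)%:E) ->
  (\int[Pi]_(t in `]0%R, +oo[) (t^-1)%:E = (mean_inv Pi)%:E)%E.
Proof.
by move=> Pi_inv; rewrite /mean_inv /Rintegral fineK//; exact: integrable_fin_num.
Qed.

Lemma mean_inv_gt0 (R : realType) (Pi : probability R R) :
  Pi `]0, +oo[%classic = 1%E ->
  Pi.-integrable `]0, +oo[%classic (fun t : R => (t^-1)%:E) -> 0 < mean_inv Pi.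
Proof.
move=> Pi_pos Pi_inv; rewrite -lte_fin -mean_inv_fine//.
apply: integral_positive_gt0 => //.
- exact: measurable_int Pi_inv.
- by move=> t; rewrite /= in_itv/= andbT => t0; rewrite lte_fin invr_gt0.
- by rewrite [X in X != _]Pi_pos oner_neq0.
Qed.

(** * Total mass and first moment of the mixture *)

Section mixture_ratio_moments.
Context {R : realType} {d : measure_display} {T : measurableType d}.
Variables (m1 m2 : nat) (Pi : probability R R) (P : probability T R).
Variables (S1 S2 : {mfun T >-> R}) (s1 s2 : R).
Local Notation mu := (@lebesgue_measure R).
Local Notation M := ((m1 + m2)%:R : R).
Local Notation g0 := (beta_kernel (m2%:R / 2 - 1) (M / 2)).
Local Notation g1 := (beta_kernel (m2%:R / 2 - 1) (M / 2 + 1)).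
Hypothesis law : forall C1 C2 : set R, measurable C1 -> measurable C2 ->
  P [set w | C1 (S1 w) /\ C2 (S2 w)] =
  (\int[Pi]_(t in `]0%R, +oo[) (scaled_chi2_prob (s1 / t) m1 C1 *
    scaled_chi2_prob (s2 / t) m2 C2))%E.
Hypotheses (s1_gt0 : 0 < s1) (s2_gt0 : 0 < s2) (M_gt0 : 0 < M).
Hypothesis Pi_pos : Pi `]0, +oo[%classic = 1%E.
Hypothesis Pi_inv : Pi.-integrable `]0, +oo[%classic (fun t : R => (t^-1)%:E).

(** The chi-square densities vanish off the positive reals, so [law] assigns the positive quadrant
    the same value as the whole plane, which has probability 1. *)
Lemma mixture_pos_as : P [set w | 0 < S1 w /\ 0 < S2 w] = 1%E.
Proof.
have scaled_pos (c : R) m : 0 < c ->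
    scaled_chi2_prob c m `]0, +oo[%classic = scaled_chi2_prob c m setT.
  move=> c0; rewrite /scaled_chi2_prob /chi2_prob.
  rewrite [LHS]integral_mkcond [RHS]integral_mkcond; apply: eq_integral => x _.
  rewrite !patchE; have [|] := ifPn; first by rewrite !mem_setT.
  rewrite notin_setE/= in_itv/= andbT pmulr_rgt0// => /negP/negbTE x0.
  by rewrite /chi2_pdf x0; case: ifP.
have <- : P [set w | `]0, +oo[%classic (S1 w) /\ `]0, +oo[%classic (S2 w)] =
    P [set w | 0 < S1 w /\ 0 < S2 w].
  by congr (P _); apply/funext => w /=; rewrite !in_itv/= !andbT.
rewrite law//.
transitivity (P [set w | setT (S1 w) /\ setT (S2 w)]).
  rewrite law//; apply: eq_integral => t; rewrite inE/= in_itv/= andbT => t0.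
  by rewrite !scaled_pos// divr_gt0.
rewrite (_ : [set w | _] = setT) ?probability_setT//.
by apply/seteqP; split.
Qed.

Lemma measurable_positive_event : measurable [set w | 0 < S1 w /\ 0 < S2 w].
Proof.
rewrite (_ : [set w | _] = S1 @^-1` `]0, +oo[ `&` S2 @^-1` `]0, +oo[).
  by apply: measurableI; rewrite -[X in measurable X]setTI; exact: measurable_funP.
by apply/seteqP; split => w; rewrite /= !in_itv/= !andbT.
Qed.

Lemma mixture_posC_negligible : P (~` [set w | 0 < S1 w /\ 0 < S2 w]) = 0%E.
Proof.
have mE := measurable_positive_event.
by rewrite probability_setC// mixture_pos_as subee.
Qed.

(** The beta-prime normalising constant [1 / B(m1/2, m2/2)]; [ratio_mass_total] identifies it as the
    reciprocal of the integral of [g0]. *)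
Definition ratio_mass : \bar R :=
  (((chi2_norm m1)^-1 / chi2_norm m2)%:E * gamma_mass (M / 2 - 1))%E.

Lemma ratio_mass_ge0 : (0 <= ratio_mass)%E.
Proof.
by rewrite mule_ge0 ?gamma_mass_ge0// lee_fin divr_ge0 ?invr_ge0 ?chi2_norm_ge0.
Qed.

Lemma integral_ratio (q : R -> R) : measurable_fun setT q -> (forall x, 0 <= q x) ->
  (\int[P]_w (if (0 < S1 w)%R then q (S2 w / S1 w) else 0)%:E =
   ratio_mass * \int[mu]_w (q (s2 / s1 * w)%R * g0 w)%:E)%E.
Proof.
move=> mq q0; have := integral_mixture_ratio law s1_gt0 0 mq q0.
rewrite !addr0 -/ratio_mass.
under eq_integral do rewrite expr0 mul1r.
move=> ->; under eq_integral do rewrite expr0.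
by rewrite integral_cst// [X in (_ * X * _)%E]Pi_pos mule1 mul1e.
Qed.

(** The weight [V] shifts the gamma mass from exponent [M/2 - 1] to [M/2], which by the recurrence
    costs the factor [2 (M/2) = M]. *)
Lemma integral_ratio_scaled (q : R -> R) : measurable_fun setT q ->
  (forall x, 0 <= q x) ->
  (\int[P]_w (if (0 < S1 w)%R then S1 w / s1 * q (S2 w / S1 w) else 0)%:E =
   (mean_inv Pi * M)%:E *
   (ratio_mass * \int[mu]_w (q (s2 / s1 * w)%R * g1 w)%:E))%E.
Proof.
move=> mq q0; have := integral_mixture_ratio law s1_gt0 1 mq q0.
under eq_integral do rewrite expr1.
move=> ->; under eq_integral do rewrite expr1.
rewrite mean_inv_fine// subrK gamma_mass_rec ?divr_gt0//.
have -> : 2 * (M / 2) = M by rewrite mulrC divfK.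
rewrite /ratio_mass (EFinM _ M) -!muleA; congr (_ * _)%E.
by rewrite muleCA.
Qed.

(** With [q = 1] the expectation is the probability of [S1 > 0]. Two nonnegative extended reals with
    product 1 are both positive and finite, which yields every nondegeneracy fact used below. *)
Lemma ratio_mass_total : (ratio_mass * \int[mu]_w (g0 w)%:E = 1)%E.
Proof.
have := @integral_ratio (fun=> 1) (measurable_cst _) (fun=> ler01).
under [in RHS]eq_integral do rewrite mul1r.
move=> <-.
have mS1 : measurable [set w | 0 < S1 w].
  rewrite (_ : [set w | _] = S1 @^-1` `]0, +oo[).
    by rewrite -[X in measurable X]setTI; exact: measurable_funP.
  by apply/seteqP; split => w; rewrite /= !in_itv/= !andbT.
transitivity (\int[P]_w (\1_[set w | (0 < S1 w)%R] w)%:E)%E.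
  apply: eq_integral => w _; rewrite indicE; congr EFin.
  by case: ifPn => w0; [rewrite mem_set|rewrite memNset//; exact/negP].
rewrite integral_indic// setIT; apply/eqP; rewrite eq_le probability_le1//=.
rewrite -mixture_pos_as; apply: le_measure; rewrite ?inE//.
- exact: measurable_positive_event.
- by move=> w [].
Qed.

Lemma ratio_mass_gt0 : (0 < ratio_mass)%E.
Proof.
rewrite lt0e ratio_mass_ge0 andbT; apply/eqP => C0.
by have := ratio_mass_total; rewrite C0 mul0e => /eqP; rewrite lt_eqF// lte_fin.
Qed.

Let g0_int_gt0 : (0 < \int[mu]_w (g0 w)%:E)%E.
Proof.
rewrite lt0e integral_ge0 ?andbT; last by move=> w _; rewrite lee_fin beta_kernel_ge0.
apply/eqP => I0.
by have := ratio_mass_total; rewrite I0 mule0 => /eqP; rewrite lt_eqF// lte_fin.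
Qed.

Lemma ratio_mass_fin : ratio_mass \is a fin_num.
Proof.
rewrite ge0_fin_numE ?ratio_mass_ge0// ltey; apply/eqP => Cy.
by have := ratio_mass_total; rewrite Cy gt0_mulye.
Qed.

Lemma integral_ratio_kernel_lty : (\int[mu]_w (g0 w)%:E < +oo)%E.
Proof.
rewrite ltey; apply/eqP => Iy.
by have := ratio_mass_total; rewrite Iy gt0_muley// ratio_mass_gt0.
Qed.

End mixture_ratio_moments.

(** The difference [g - f] has positive integral already over [D]; finiteness of the integral of [g]
    keeps the addition of this amount strict. *)
Lemma lt_integral (d : measure_display) (T : measurableType d) (R : realType)
    (m : {measure set T -> \bar R}) (D : set T) (f g : T -> \bar R) :
  measurable_fun setT f -> measurable_fun setT g ->
  (forall x, 0 <= f x)%E -> (forall x, f x <= g x)%E ->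
  (forall x, g x \is a fin_num) -> (\int[m]_x g x < +oo)%E ->
  measurable D -> m D != 0%E -> (forall x, D x -> f x < g x)%E ->
  (\int[m]_x f x < \int[m]_x g x)%E.
Proof.
move=> mf mg f0 fg gfin gint mD mD0 fgD.
have ffin x : f x \is a fin_num.
  by rewrite ge0_fin_numE// (le_lt_trans (fg x))// -ge0_fin_numE// (le_trans (f0 x)).
have gf0 x : (0 <= g x - f x)%E by rewrite sube_ge0 ?fg// ffin.
have mgf : measurable_fun setT (fun x => g x - f x)%E by exact: emeasurable_funB.
have -> : (\int[m]_x g x = \int[m]_x f x + \int[m]_x (g x - f x))%E.
  rewrite -ge0_integralD//; apply: eq_integral => x _.
  by rewrite addeC subeK.
have int0 : (0 < \int[m]_x (g x - f x))%E.
  apply: (@lt_le_trans _ _ (\int[m]_(x in D) (g x - f x))%E).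
    apply: integral_positive_gt0 => //; first exact: measurable_funTS.
    by move=> x Dx; rewrite sube_gt0 fgD.
  by apply: ge0_subset_integral.
rewrite lteDl// ge0_fin_numE; last exact: integral_ge0.
by apply: le_lt_trans gint; exact: ge0_le_integral.
Qed.

(** * Layer-cake formulas for the identity and the logarithm *)

Section layer_cake.
Context {R : realType}.
Local Notation mu := (@lebesgue_measure R).

Lemma layer_cake_id (p al : R) : 0 < p -> p <= al ->
  (\int[mu]_c (if (0 < c < al)%R then ((p < c)%R : nat)%:R else 0)%:E =
   (al - p)%:E)%E.
Proof.
move=> p0 pal.
transitivity (\int[mu]_c (\1_(`]p, al[%classic) c)%:E)%E.
  apply: eq_integral => c _; rewrite indicE; congr EFin.
  rewrite mem_setE in_itv/=; have [pc|cp] := ltP p c; last by case: ifP.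
  by rewrite (lt_trans p0 pc)/=; case: ifP.
rewrite integral_indic// setIT [LHS]lebesgue_measure_itv/= lte_fin.
case: ltP => [_|alp]; first by rewrite EFinB.
by rewrite (_ : p = al) ?subrr//; apply/eqP; rewrite eq_le pal.
Qed.

Lemma layer_cake_ln (p al : R) : 0 < p -> p <= al ->
  (\int[mu]_c (if (0 < c < al)%R then c^-1 * ((p < c)%R : nat)%:R else 0)%:E =
   (ln al - ln p)%:E)%E.
Proof.
move=> p0 pal.
transitivity (\int[mu]_(c in `]p, al[) (c^-1)%:E)%E.
  rewrite [RHS]integral_mkcond; apply: eq_integral => c _.
  rewrite patchE mem_setE in_itv/=; have [pc|cp] := ltP p c.
    by rewrite (lt_trans p0 pc)/= mulr1; case: ifP.
  by rewrite mulr0; case: ifP.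
move: pal; rewrite le_eqVlt => /orP[/eqP <-|pal].
  by rewrite set_itv_ge ?bnd_simp ?ltxx// integral_set0 subrr.
have dln (x : R) : p <= x -> is_derive x 1 (@ln R) x^-1.
  by move=> px; apply: is_derive1_ln; exact: lt_le_trans px.
have cln (x : R) : p <= x -> {for x, continuous (@ln R)}.
  by move=> px; apply: continuous_ln; exact: lt_le_trans px.
have minv : measurable_fun `]p, al[ (fun c : R => (c^-1)%:E).
  by apply/measurable_EFinP/measurable_funTS; exact: measurable_invr.
rewrite -(@integral_itv_bndoo _ _ _ _ true false minv) EFinB.
apply: continuous_FTC2 => //.
- apply: continuous_in_subspaceT => x; rewrite inE/= in_itv/= => /andP[px _].
  by apply: inv_continuous; rewrite gt_eqF// (lt_le_trans p0).
- split.
  + move=> x; rewrite in_itv/= => /andP[px _].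
    exact: (@ex_derive _ _ _ _ _ _ _ (dln x (ltW px))).
  + by apply: cvg_at_right_filter; exact: cln.
  + by apply: cvg_at_left_filter; apply: cln; exact: ltW.
- move=> x; rewrite in_itv/= => /andP[px _].
  by rewrite derive1E; exact: (@derive_val _ _ _ _ _ _ _ (dln x (ltW px))).
Qed.

End layer_cake.

(** * Risk comparison at fixed parameters, with [s1] and [s2] the squared scales *)

Section domination.
Context {R : realType} {d : measure_display} {T : measurableType d}.
Variables (m1 m2 : nat) (Pi : probability R R) (P : probability T R).
Variables (S1 S2 : {mfun T >-> R}) (s1 s2 : R) (phi : R -> R) (al : R).
Local Notation mu := (@lebesgue_measure R).
Local Notation M := ((m1 + m2)%:R : R).
Local Notation g0 := (beta_kernel (m2%:R / 2 - 1) (M / 2)).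
Local Notation g1 := (beta_kernel (m2%:R / 2 - 1) (M / 2 + 1)).
Hypothesis law : forall C1 C2 : set R, measurable C1 -> measurable C2 ->
  P [set w | C1 (S1 w) /\ C2 (S2 w)] =
  (\int[Pi]_(t in `]0%R, +oo[) (scaled_chi2_prob (s1 / t) m1 C1 *
    scaled_chi2_prob (s2 / t) m2 C2))%E.
Hypotheses (s1_gt0 : 0 < s1) (s12 : s1 <= s2) (M_gt0 : 0 < M).
Hypothesis Pi_pos : Pi `]0, +oo[%classic = 1%E.
Hypothesis Pi_inv : Pi.-integrable `]0, +oo[%classic (fun t : R => (t^-1)%:E).
Hypothesis phi_pos : forall u : R, 0 < u -> 0 < phi u.
Hypothesis phi_nd : forall u v : R, 0 < u -> u <= v -> phi u <= phi v.
Hypothesis phi_le : forall u : R, 0 < u -> phi u <= al.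
Hypothesis phi_lim : forall c : R, c < al -> exists2 u : R, 0 < u & c <= phi u.
Hypothesis phi_ge : forall u : R, 0 < u -> lower_bound m1 m2 Pi u <= phi u.

Let s2_gt0 : 0 < s2. Proof. exact: lt_le_trans s12. Qed.

Let al_gt0 : 0 < al.
Proof. by apply: lt_le_trans (phi_le ltr01); exact: phi_pos. Qed.

Let mi_gt0 : 0 < mean_inv Pi. Proof. exact: mean_inv_gt0. Qed.

Local Notation C := (@ratio_mass R m1 m2).

Let C_gt0 : (0 < C)%E := ratio_mass_gt0 law s1_gt0 s2_gt0 Pi_pos.
Let C_fin : C \is a fin_num := ratio_mass_fin law s1_gt0 s2_gt0 Pi_pos.
Let g0_fin : (\int[mu]_w (g0 w)%:E < +oo)%E :=
  integral_ratio_kernel_lty law s1_gt0 s2_gt0 Pi_pos.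

(** The same extension as in [delta_phi]. Since [phi] is positive, it is nondecreasing on the whole
    line, hence measurable. *)
Let psi (u : R) : R := if 0 < u then phi u else 0.

Let mpsi : measurable_fun setT psi.
Proof.
apply: nondecreasing_measurable => // x y xy; rewrite /psi.
have [x0|x0] := ltP 0 x; first by rewrite (lt_le_trans x0 xy) phi_nd.
by case: ifP => // y0; exact/ltW/phi_pos.
Qed.

Let Z w := S2 w / S1 w.

Let mZ : measurable_fun setT Z.
Proof.
apply: measurable_funM => //.
exact: (@measurableT_comp _ _ _ _ _ _ (@GRing.inv R) _ S1 measurable_invr).
Qed.

(* With [V = S1 / s1], the gain [(al - phi Z) V] and the loss
   [ln al - ln (phi Z)] are the integrals over [0 < c < al] of their slices
   [V 1{phi Z < c}] and [1{phi Z < c} / c]. *)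
Let gain_slice (z : T * R) : R := if 0 < z.2 < al then
  (if 0 < S1 z.1 then S1 z.1 / s1 * below phi z.2 (Z z.1) else 0) else 0.

Let loss_slice (z : T * R) : R := if 0 < z.2 < al then
  (if 0 < S1 z.1 then z.2^-1 * below phi z.2 (Z z.1) else 0) else 0.

Let mbelow : measurable_fun setT (fun z : T * R => below phi z.2 (Z z.1)).
Proof.
have -> : (fun z : T * R => below phi z.2 (Z z.1)) =
    (fun z => if (0 < Z z.1) && (psi (Z z.1) < z.2) then 1 else 0).
  by apply/funext => z; rewrite /below /psi; case: ltP => //= _; case: ltP.
have mZ1 : measurable_fun setT (fun z : T * R => Z z.1).
  exact: (measurableT_comp mZ).
apply: measurable_fun_ifT => //; apply: measurable_and.
- exact: measurable_fun_ltr.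
- by apply: measurable_fun_ltr => //; exact: (measurableT_comp mpsi).
Qed.

Let mS1 : measurable_fun setT (fun z : T * R => S1 z.1).
Proof. exact: (@measurableT_comp _ _ _ _ _ _ S1 _ fst). Qed.

Let mslice (f : T * R -> R) : measurable_fun setT f ->
  measurable_fun setT (fun z : T * R => if 0 < z.2 < al then
    (if 0 < S1 z.1 then f z else 0) else 0).
Proof.
move=> mf; apply: measurable_fun_ifT => //.
  by apply: measurable_and; exact: measurable_fun_ltr.
apply: measurable_fun_ifT => //; exact: measurable_fun_ltr.
Qed.

Let mgain : measurable_fun setT (EFin \o gain_slice).
Proof.
apply/measurable_EFinP.
apply: (@mslice (fun z => S1 z.1 / s1 * below phi z.2 (Z z.1))).
by apply: measurable_funM => //; exact: measurable_funM.
Qed.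

Let mloss : measurable_fun setT (EFin \o loss_slice).
Proof.
apply/measurable_EFinP.
apply: (@mslice (fun z => z.2^-1 * below phi z.2 (Z z.1))).
apply: measurable_funM => //.
exact: (@measurableT_comp _ _ _ _ _ _ (@GRing.inv R) _ snd measurable_invr).
Qed.

Let gain0 z : (0 <= (EFin \o gain_slice) z)%E.
Proof.
rewrite /= lee_fin /gain_slice; case: ifP => // _; case: ifPn => // S0.
by rewrite mulr_ge0 ?below_ge0// divr_ge0 ?ltW.
Qed.

Let loss0 z : (0 <= (EFin \o loss_slice) z)%E.
Proof.
rewrite /= lee_fin /loss_slice; case: ifPn => // /andP[z0 _]; case: ifPn => // S0.
by rewrite mulr_ge0 ?below_ge0// invr_ge0 ltW.
Qed.

Let a c := (\int[P]_w (gain_slice (w, c))%:E)%E.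
Let b c := (\int[P]_w (loss_slice (w, c))%:E)%E.

Let a0 c : (0 <= a c)%E.
Proof. by apply: integral_ge0 => w _; exact: (gain0 (w, c)). Qed.

Let b0 c : (0 <= b c)%E.
Proof. by apply: integral_ge0 => w _; exact: (loss0 (w, c)). Qed.

Let mbelowc c : measurable_fun setT (below phi c).
Proof. exact: measurable_below. Qed.

(** A factor [c^-1] is pulled out against an inserted [c], so that [a c] and [b c] share the
    prefactor [c^-1 C] and differ exactly by the two sides of [integral_below_le]. *)
Let aE c : 0 < c < al -> a c = ((c^-1)%:E * C * ((c * mean_inv Pi * M)%:E *
  \int[mu]_w (below phi c (s2 / s1 * w) * g1 w)%:E))%E.
Proof.
move=> cal; have /andP[c0 _] := cal.
rewrite /a /gain_slice/= cal.
rewrite (integral_ratio_scaled law s1_gt0 M_gt0 Pi_inv (mbelowc c)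
  (below_ge0 phi c)).
move: C => K; rewrite !muleA; congr (_ * _)%E.
rewrite [RHS]muleAC -EFinM; congr (_%:E * _)%E.
by rewrite !mulrA mulVf ?mul1r// gt_eqF.
Qed.

Let bE c : 0 < c < al -> b c = ((c^-1)%:E * C *
  \int[mu]_w (below phi c (s2 / s1 * w) * g0 w)%:E)%E.
Proof.
move=> cal; have /andP[c0 _] := cal.
rewrite /b /loss_slice/= cal.
transitivity (\int[P]_w ((c^-1)%:E *
    (if (0 < S1 w)%R then below phi c (S2 w / S1 w) else 0)%:E))%E.
  by apply: eq_integral => w _; rewrite -EFinM; case: ifP => //; rewrite mulr0.
rewrite ge0_integralZl//; last 3 first.
- apply/measurable_EFinP; apply: measurable_fun_ifT => //.
    exact: measurable_fun_ltr.
  exact: (measurableT_comp (mbelowc c)).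
- by move=> w _; rewrite lee_fin; case: ifP => // _; exact: below_ge0.
- by rewrite lee_fin invr_ge0 ltW.
rewrite (integral_ratio law s1_gt0 Pi_pos (mbelowc c) (below_ge0 phi c)).
by rewrite muleA.
Qed.

Let outside c : ~~ (0 < c < al) -> a c = 0%E /\ b c = 0%E.
Proof.
move=> /negbTE cal; rewrite /a /b /gain_slice /loss_slice/= cal.
by split; rewrite integral0_eq.
Qed.

Let k_ge1 : 1 <= s2 / s1. Proof. by rewrite ler_pdivlMr// mul1r. Qed.

Let cC_gt0 c : 0 < c -> (0 < (c^-1)%:E * C)%E.
Proof. by move=> c0; rewrite mule_gt0// lte_fin invr_gt0. Qed.

Let ba c : (b c <= a c)%E.
Proof.
have [cal|/outside[-> ->]//] := boolP (0 < c < al).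
have /andP[c0 ca] := cal; rewrite aE// bE//; apply: lee_wpmul2l.
  exact/ltW/cC_gt0.
by apply: integral_below_le => //; exact: phi_lim.
Qed.

Let ba_lt c u : s1 < s2 -> 0 < u -> phi u < c -> c < al -> (b c < a c)%E.
Proof.
move=> lt12 u0 uc ca; have c0 : 0 < c by apply: lt_trans uc; exact: phi_pos.
have cal : 0 < c < al by rewrite c0.
rewrite aE// bE// lte_pmul2l ?cC_gt0//; last by rewrite fin_numM.
apply: integral_below_lt => //; first by rewrite ltr_pdivlMr// mul1r.
- exact: phi_lim.
- exists (u / (s2 / s1)); first by rewrite divr_gt0// divr_gt0.
  by rewrite mulrC divfK// gt_eqF// divr_gt0.
Qed.

(** Dropping the indicator and replacing [g1] by [g0] leaves total mass 1. The bound is crude, but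
    it is constant in [c] over a bounded range of levels and so makes the expected gain finite. *)
Let a_le c : (a c <= (if 0 < c < al then mean_inv Pi * M else 0)%:E)%E.
Proof.
have [cal|/outside[-> //]] := boolP (0 < c < al).
rewrite /a /gain_slice/= cal.
rewrite (integral_ratio_scaled law s1_gt0 M_gt0 Pi_inv (mbelowc c)
  (below_ge0 phi c)).
rewrite -[leRHS]mule1 -(ratio_mass_total law s1_gt0 s2_gt0 Pi_pos).
apply: lee_wpmul2l; first by rewrite lee_fin mulr_ge0 ?ltW.
apply: lee_wpmul2l; first exact: ltW.
apply: ge0_le_integral => //.
- by move=> w _; rewrite lee_fin mulr_ge0 ?below_ge0 ?beta_kernel_ge0.
- apply/measurable_EFinP; apply: measurable_funM; last exact: measurable_beta_kernel.
  by apply: (measurableT_comp (mbelowc c)); exact: measurable_funM.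
- by apply/measurable_EFinP; exact: measurable_beta_kernel.
- move=> w _; rewrite lee_fin.
  apply: le_trans (beta_kernelS_le _ _ _); rewrite ler_piMl ?beta_kernel_ge0//.
  by rewrite /below; case: andb.
Qed.

Let ma : measurable_fun setT a.
Proof. exact: (measurable_fun_fubini_tonelli_G (EFin \o gain_slice) mgain gain0). Qed.

Let mb : measurable_fun setT b.
Proof. exact: (measurable_fun_fubini_tonelli_G (EFin \o loss_slice) mloss loss0). Qed.

Let a_int_fin : (\int[mu]_c a c < +oo)%E.
Proof.
apply: (@le_lt_trans _ _ (\int[mu]_c (if 0 < c < al then mean_inv Pi * M else 0)%:E)%E).
  apply: ge0_le_integral => //.
  apply/measurable_EFinP; apply: measurable_fun_ifT => //.
  by apply: measurable_and; exact: measurable_fun_ltr.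
rewrite [ltLHS](_ : _ = \int[mu]_c
    ((mean_inv Pi * M)%:E * (\1_`]0%R, al[%classic c)%:E))%E; last first.
  apply: eq_integral => c _; rewrite -EFinM indicE mem_setE in_itv/=; congr EFin.
  by case: ifP; rewrite ?mulr1 ?mulr0.
rewrite ge0_integralZl//; last 2 first.
- exact/measurable_EFinP/measurable_indic.
- by rewrite lee_fin mulr_ge0 ?ltW.
rewrite integral_indic// setIT [X in (_ * X)%E]lebesgue_measure_itv/=.
by rewrite lte_fin al_gt0 -EFinB -EFinM ltry.
Qed.

Let pos w := (0 < S1 w) && (0 < S2 w).

(** Both corrections are 0 off the almost sure event [pos], so that they are nonnegative and equal
    to the integrals of their slices at every point. *)
Let gain w : R := if pos w then S1 w / s1 * (al - phi (Z w)) else 0.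
Let logloss w : R := if pos w then ln al - ln (phi (Z w)) else 0.

Let Z_gt0 w : pos w -> 0 < Z w. Proof. by case/andP=> *; rewrite divr_gt0. Qed.

Let not_pos_below w c : 0 < S1 w -> ~~ pos w -> below phi c (Z w) = 0.
Proof.
rewrite /pos => S10; rewrite S10/= => nS2.
by rewrite /below /Z pmulr_lgt0 ?invr_gt0// (negbTE nS2).
Qed.

Let gainE w : (\int[mu]_c (gain_slice (w, c))%:E = (gain w)%:E)%E.
Proof.
rewrite /gain /gain_slice/=; case: ifPn => [pw|npw]; last first.
  rewrite integral0_eq// => c _; case: ifP => // _; case: ifPn => // S10.
  by rewrite not_pos_below// mulr0.
have Z0 := Z_gt0 pw; have /andP[S10 S20] := pw.
rewrite EFinM -layer_cake_id ?phi_pos ?phi_le// -ge0_integralZl//; last 3 first.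
- apply/measurable_EFinP; apply: measurable_fun_ifT => //.
    by apply: measurable_and; exact: measurable_fun_ltr.
  rewrite (_ : (fun c => _) = (fun c => if phi (Z w) < c then 1 else 0)).
    by apply: measurable_fun_ifT => //; exact: measurable_fun_ltr.
  by apply/funext => c; case: ltP.
- by move=> c _; rewrite lee_fin; case: ifP.
- by rewrite lee_fin divr_ge0 ?ltW.
apply: eq_integral => c _; rewrite S10 -EFinM /below Z0/=; congr EFin.
by case: ifP => //; rewrite mulr0.
Qed.

Let loglossE w : (\int[mu]_c (loss_slice (w, c))%:E = (logloss w)%:E)%E.
Proof.
rewrite /logloss /loss_slice/=; case: ifPn => [pw|npw]; last first.
  rewrite integral0_eq// => c _; case: ifP => // _; case: ifPn => // S10.
  by rewrite not_pos_below// mulr0.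
have Z0 := Z_gt0 pw; have /andP[S10 S20] := pw.
rewrite -layer_cake_ln ?phi_pos ?phi_le//.
by apply: eq_integral => c _; rewrite S10 /below Z0.
Qed.

Let EgainE : (\int[P]_w (gain w)%:E = \int[mu]_c a c)%E.
Proof.
under eq_integral do rewrite -gainE.
exact: (@fubini_tonelli _ _ T (measurableTypeR R) R P mu _ mgain gain0).
Qed.

Let EloglossE : (\int[P]_w (logloss w)%:E = \int[mu]_c b c)%E.
Proof.
under eq_integral do rewrite -loglossE.
exact: (@fubini_tonelli _ _ T (measurableTypeR R) R P mu _ mloss loss0).
Qed.

Let expected_logloss_le : (\int[P]_w (logloss w)%:E <= \int[P]_w (gain w)%:E)%E.
Proof.
by rewrite EgainE EloglossE; apply: ge0_le_integral => // c _; exact: ba.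
Qed.

Let expected_gain_fin : (\int[P]_w (gain w)%:E < +oo)%E.
Proof. by rewrite EgainE. Qed.

(** Every level between [phi u] and [al] has a strict slice inequality, and these levels form an
    interval of positive length. *)
Let expected_logloss_lt u : s1 < s2 -> 0 < u -> phi u < al ->
  (\int[P]_w (logloss w)%:E < \int[P]_w (gain w)%:E)%E.
Proof.
move=> lt12 u0 ual; rewrite EgainE EloglossE.
apply: (@lt_integral _ (measurableTypeR R) R mu `]phi u, al[%classic b a) => //.
- move=> c; rewrite ge0_fin_numE//.
  by apply: le_lt_trans (a_le c) _; rewrite ltry.
- by rewrite /= lebesgue_measure_itv/= lte_fin ual -EFinB gt_eqF// lte_fin subr_gt0.
- by move=> c; rewrite /= in_itv/= => /andP[uc cal]; exact: (ba_lt lt12 u0).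
Qed.

Let phi_loss w := entropy_loss (delta_phi phi S1 S2 w) s1.
Let baee_loss w := entropy_loss (al * S1 w) s1.

(** For [S1 w <= 0] the loss formula can be negative, [ln] being 0 there by convention; truncation
    to [pos] makes the losses nonnegative without changing their integrals. *)
Let pos_part (f : T -> R) w := if pos w then f w else 0.

Let mpos : measurable_fun setT pos.
Proof. by apply: measurable_and; exact: measurable_fun_ltr. Qed.

Let mloss_of (f : T -> R) : measurable_fun setT f ->
  measurable_fun setT (fun w => entropy_loss (f w) s1).
Proof.
move=> mf; have mfs : measurable_fun setT (fun w => f w / s1) by exact: measurable_funM.
apply: measurable_funB => //; apply: measurable_funB => //.
exact: (measurableT_comp (@measurable_ln R)).
Qed.

Let mphi_loss : measurable_fun setT phi_loss.
Proof.
apply: mloss_of; apply: measurable_funM => //; exact: (measurableT_comp mpsi).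
Qed.

Let mbaee_loss : measurable_fun setT baee_loss.
Proof. by apply: mloss_of; exact: measurable_funM. Qed.

Let integral_pos_part (f : T -> R) : measurable_fun setT f ->
  (\int[P]_w (f w)%:E = \int[P]_w (pos_part f w)%:E)%E.
Proof.
move=> mf; apply: ae_eq_integral => //; first exact/measurable_EFinP.
  by apply/measurable_EFinP; exact: measurable_fun_ifT.
exists (~` [set w | 0 < S1 w /\ 0 < S2 w]); split.
- by apply: measurableC; exact: measurable_positive_event.
- exact: (mixture_posC_negligible law s1_gt0 s2_gt0).
- move=> w /= /not_implyP[_ neq] [S10 S20]; apply: neq.
  by rewrite /pos_part /pos S10 S20.
Qed.

Let entropy_loss_ge0 (x : R) : 0 < x -> 0 <= entropy_loss x s1.
Proof.
move=> x0; have y0 : 0 < x / s1 by rewrite divr_gt0.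
rewrite /entropy_loss; have := @le_ln1Dx R (x / s1 - 1).
by rewrite (addrC 1) subrK => /(_ ltac:(lra)); lra.
Qed.

Let phi_loss_ge0 w : 0 <= pos_part phi_loss w.
Proof.
rewrite /pos_part; case: ifPn => // pw; apply: entropy_loss_ge0.
rewrite /delta_phi/= (Z_gt0 pw) mulr_gt0 ?phi_pos ?Z_gt0//.
by case/andP: pw.
Qed.

Let baee_loss_ge0 w : 0 <= pos_part baee_loss w.
Proof.
rewrite /pos_part; case: ifPn => // pw; apply: entropy_loss_ge0.
by rewrite mulr_gt0//; case/andP: pw.
Qed.

Let lossE w : pos_part phi_loss w + gain w = pos_part baee_loss w + logloss w.
Proof.
rewrite /pos_part /gain /logloss; case: ifPn => pw; last by rewrite !addr0.
rewrite /phi_loss /baee_loss /delta_phi/= (Z_gt0 pw) /entropy_loss.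
have V0 : 0 < S1 w / s1 by rewrite divr_gt0//; case/andP: pw.
have p0 : 0 < phi (Z w) by rewrite phi_pos ?Z_gt0.
have lnV (x : R) : 0 < x -> ln (x * S1 w / s1) = ln x + ln (S1 w / s1).
  by move=> x0; rewrite -mulrA lnM ?posrE.
by rewrite -/(Z w) !lnV//; ring.
Qed.

Let gain_ge0 w : 0 <= gain w.
Proof. by rewrite -lee_fin -gainE; apply: integral_ge0 => c _; exact: (gain0 (w, c)). Qed.

Let logloss_ge0 w : 0 <= logloss w.
Proof. by rewrite -lee_fin -loglossE; apply: integral_ge0 => c _; exact: (loss0 (w, c)). Qed.

Let mEgain : measurable_fun setT (fun w => (gain w)%:E).
Proof.
rewrite (_ : (fun w => _) = (fun w => \int[mu]_c (gain_slice (w, c))%:E)%E).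
  exact: (@measurable_fun_fubini_tonelli_F _ _ T (measurableTypeR R) R mu _ mgain gain0).
by apply/funext => w; rewrite gainE.
Qed.

Let mElogloss : measurable_fun setT (fun w => (logloss w)%:E).
Proof.
rewrite (_ : (fun w => _) = (fun w => \int[mu]_c (loss_slice (w, c))%:E)%E).
  exact: (@measurable_fun_fubini_tonelli_F _ _ T (measurableTypeR R) R mu _ mloss loss0).
by apply/funext => w; rewrite loglossE.
Qed.

Let mpos_part f : measurable_fun setT f ->
  measurable_fun setT (fun w => (pos_part f w)%:E).
Proof. by move=> mf; apply/measurable_EFinP; exact: measurable_fun_ifT. Qed.

(** All four integrands are nonnegative after truncation, so the pointwise identity [lossE]
    integrates even if the risks are infinite. *)
Let risk_identity :
  (\int[P]_w (phi_loss w)%:E + \int[P]_w (gain w)%:E =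
   \int[P]_w (baee_loss w)%:E + \int[P]_w (logloss w)%:E)%E.
Proof.
rewrite (integral_pos_part mphi_loss) (integral_pos_part mbaee_loss).
rewrite -!ge0_integralD//; last 6 first.
- by move=> w _; rewrite lee_fin.
- exact: mpos_part.
- by move=> w _; rewrite lee_fin.
- by move=> w _; rewrite lee_fin.
- exact: mpos_part.
- by move=> w _; rewrite lee_fin.
by apply: eq_integral => w _; rewrite -!EFinD lossE.
Qed.

Let gain_fin_num : (\int[P]_w (gain w)%:E)%E \is a fin_num.
Proof.
rewrite ge0_fin_numE ?expected_gain_fin//.
by apply: integral_ge0 => w _; rewrite lee_fin.
Qed.

Lemma expected_entropy_loss_le :
  (\int[P]_w (entropy_loss (delta_phi phi S1 S2 w) s1)%:E <=
   \int[P]_w (entropy_loss (al * S1 w) s1)%:E)%E.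
Proof.
by rewrite -(leeD2rE _ _ gain_fin_num) risk_identity leeD2l.
Qed.

(** If the risk of [al * S1] were infinite, [risk_identity] with its finite expected gain would make
    the other risk infinite too. Finiteness lets the strict inequality between the corrections pass
    to the risks. *)
Lemma expected_entropy_loss_lt u : s1 < s2 -> 0 < u -> phi u < al ->
  (\int[P]_w (entropy_loss (al * S1 w) s1)%:E < +oo)%E ->
  (\int[P]_w (entropy_loss (delta_phi phi S1 S2 w) s1)%:E <
   \int[P]_w (entropy_loss (al * S1 w) s1)%:E)%E.
Proof.
move=> lt12 u0 ual fin; rewrite -(lteD2rE _ _ gain_fin_num) risk_identity.
rewrite lteD2lE ?(expected_logloss_lt lt12 u0)//.
rewrite ge0_fin_numE// (integral_pos_part mbaee_loss).
by apply: integral_ge0 => w _; rewrite lee_fin.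
Qed.

End domination.

(** * From the full model to the pair [(S1, S2)], and the theorem *)

Lemma mixture_model_marginal (R : realType) (d : measure_display)
    (T : measurableType d) (p q m1 m2 : nat) (Pi : probability R R)
    (tau : {mfun T >-> R}) (X1 : {mfun T >-> p.-tuple R}) (S1 : {mfun T >-> R})
    (X2 : {mfun T >-> q.-tuple R}) (S2 : {mfun T >-> R}) (th : params R p q)
    (P : probability T R) (C1 C2 : set R) :
  mixture_model m1 m2 Pi tau X1 S1 X2 S2 th P -> measurable C1 -> measurable C2 ->
  P [set w | C1 (S1 w) /\ C2 (S2 w)] =
  (\int[Pi]_(t in `]0%R, +oo[)
    (scaled_chi2_prob (sigma1 th ^+ 2 / t) m1 C1 *
     scaled_chi2_prob (sigma2 th ^+ 2 / t) m2 C2))%E.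
Proof.
move=> model mC1 mC2.
have boxT n (theta : n.-tuple R) (v : R) : mvnormal_box theta v (fun=> setT) = 1%E.
  by rewrite /mvnormal_box big1// => i _; rewrite probability_setT.
have := model setT (fun=> setT) C1 (fun=> setT) C2 measurableT
  (fun=> measurableT) mC1 (fun=> measurableT) mC2.
rewrite setTI => modelE.
rewrite (_ : [set w | _ ] = [set w | [/\ setT (tau w),
  (forall i : 'I_p, setT (tnth (X1 w) i)), C1 (S1 w),
  (forall j : 'I_q, setT (tnth (X2 w) j)) & C2 (S2 w)]]).
  by rewrite modelE; apply: eq_integral => t _; rewrite !boxT mul1e mule1.
by apply/seteqP; split => w /= [].
Qed.

Unset Implicit Arguments.
Set Strict Implicit.

Theorem theorem2p8 (R : realType) (p q m1 m2 : nat)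
    (p_gt0 : (0 < p)%N) (q_gt0 : (0 < q)%N)
    (m1_gt0 : (0 < m1)%N) (m2_gt0 : (0 < m2)%N)
    (Pi : probability R R)
    (Pi_pos : Pi `]0, +oo[%classic = 1%E)
    (Pi_inv : Pi.-integrable `]0, +oo[%classic (fun t : R => (t^-1)%:E))
    (d : measure_display) (T : measurableType d)
    (tau : {mfun T >-> R})
    (X1 : {mfun T >-> p.-tuple R}) (S1 : {mfun T >-> R})
    (X2 : {mfun T >-> q.-tuple R}) (S2 : {mfun T >-> R})
    (P : params R p q -> probability T R)
    (model : forall th : params R p q, order_restricted th ->
       mixture_model m1 m2 Pi tau X1 S1 X2 S2 th (P th))
    (phi1 : R -> R)
    (phi1_pos : forall u : R, 0 < u -> 0 < phi1 u)
    (phi1_nondecr : forall u v : R, 0 < u -> u <= v -> phi1 u <= phi1 v)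
    (phi1_lim : phi1 u @[u --> +oo] --> alpha1E m1 Pi)
    (phi1_ge : forall u : R, 0 < u -> lower_bound m1 m2 Pi u <= phi1 u) :
  no_worse P (delta_phi phi1 S1 S2) (baee1 m1 Pi S1) /\
  ((exists2 u : R, 0 < u & phi1 u <> alpha1E m1 Pi) ->
   (forall th : params R p q, order_restricted th ->
      (risk P (baee1 m1 Pi S1) th < +oo)%E) ->
   dominates P (delta_phi phi1 S1 S2) (baee1 m1 Pi S1)).
Proof.
(* The limit at infinity enters only in this form: a nondecreasing function stays below its limit
   and exceeds every smaller level. The second fact bounds the sublevel sets for [c] below the
   limit. *)
have [phi_le phi_ex] : (forall u, 0 < u -> phi1 u <= alpha1E m1 Pi) /\
    (forall c, c < alpha1E m1 Pi -> exists2 u, 0 < u & c <= phi1 u).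
  split=> [u u0|c cal].
    rewrite leNgt; apply/negP => alu.
    have : \forall x \near +oo, phi1 x < phi1 u by exact: cvgr_lt phi1_lim _ alu.
    move=> near_lt.
    have [x [xu ux]] := @filter_ex _ (pinfty_nbhs R) _ _
      (filterI near_lt (nbhs_pinfty_ge (num_real u))).
    by move: xu; rewrite ltNge phi1_nondecr.
  have near_gt : \forall x \near +oo, c < phi1 x by exact: cvgr_gt phi1_lim _ cal.
  have [x [cx x0]] := @filter_ex _ (pinfty_nbhs R) _ _
    (filterI near_gt (nbhs_pinfty_gt (num_real 0))).
  by exists x => //; exact: ltW.
have M_gt0 : 0 < (m1 + m2)%:R :> R by rewrite ltr0n addn_gt0 m1_gt0.
have riskE delta th : risk P delta th =
    (\int[P th]_w (entropy_loss (delta w) (sigma1 th ^+ 2))%:E)%E.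
  by rewrite /risk unlock.
have nw : no_worse P (delta_phi phi1 S1 S2) (baee1 m1 Pi S1).
  move=> th ord; have [s1_gt0 s2_gt0 s12] := ord.
  rewrite !riskE.
  apply: (@expected_entropy_loss_le _ _ _ m1 m2 Pi (P th) S1 S2 _ (sigma2 th ^+ 2)) => //.
  - by move=> C1 C2; exact: mixture_model_marginal (model th ord).
  - by rewrite exprn_gt0.
  - by rewrite ler_pXn2r// nnegrE ltW.
(* If [phi1] were equal to its limit on all of [(0, +oo)], the two estimators would agree almost
   surely; the point [u] rules this out. *)
split=> // -[u u0 /eqP phi_u] baee_fin; split => //.
(* Any parameters with [sigma1 < sigma2] would serve, since strictness comes from a ratio of
   variances above 1; here it is 4. *)
pose th := @Params R p q (nseq_tuple p 0) (nseq_tuple q 0) 1 2.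
have ord : order_restricted th by split => /=; lra.
exists th => //; move: (baee_fin th ord); rewrite !riskE => fin.
apply: (@expected_entropy_loss_lt _ _ _ m1 m2 Pi (P th) S1 S2 _ (sigma2 th ^+ 2)
  phi1 (alpha1E m1 Pi) _ _ _ _ _ _ _ _ _ _ _ u) => //=.
- by move=> C1 C2; exact: mixture_model_marginal (model th ord).
- by rewrite expr1n -natrX ler1n.
- by rewrite expr1n -natrX ltr1n.
- by rewrite lt_neqAle phi_u phi_le.
Qed.
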